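(* For any $\varepsilon,\gamma>0$ and integer $d\ge3$ there exists $\delta=\delta(\varepsilon,\gamma,d)>0$ such that the following holds. Let $G$ be a Cayley graph with degree $d$ and external vertex Cheeger constant $\gamma$, and let $X=(X_v)_{v\in V(G)}\in\{0,1\}^{V(G)}$ be any FIID or weak FIID site percolation on $G$. If $\mathbb E[\deg_X(o)\mid X_o=1]\ge d(1-\delta)$, then $\mathbb P(X_o=1)\ge 1-\varepsilon$.
   Context: $G=\mathrm{Cay}(\Gamma,S)$ with $\Gamma$ an infinite group and $S$ a finite symmetric generating set; $o$ is the vertex of the identity. The external vertex Cheeger constant of $G$ is $\inf_W |\partial_V^{\mathrm{ext}}W|/|W|$ over finite nonempty $W\subset V(G)$, where $\partial_V^{\mathrm{ext}}W$ is the set of vertices outside $W$ with a neighbour in $W$. A site percolation $X$ is a random element of $\{0,1\}^{V(G)}$ with $\Gamma$-invariant law, identified with the random set $\{v:X_v=1\}$; $\deg_X(o)$ is the number of neighbours $v$ of $o$ in $G$ with $X_v=1$. The conditional expectation presupposes $\mathbb P(X_o=1)>0$. FIID: $X=F(U)$ with $U$ i.i.d. $\mathrm{Unif}[0,1]$ labels on $V(G)$ or $E(G)$ and $F$ a measurable $\Gamma$-equivariant map. Weak FIID: the law of $X$ is a weak limit (product topology) of laws of FIID site percolations. *)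

(* Defs.v *)
From HB Require Import structures.
From mathcomp Require Import all_boot all_order all_algebra finmap.
From mathcomp Require Import all_classical all_reals all_analysis.

Set Implicit Arguments.
Unset Strict Implicit.
Unset Printing Implicit Defensive.

Import Order.TTheory GRing.Theory Num.Theory.
Import numFieldNormedType.Exports.

Local Open Scope classical_set_scope.
Local Open Scope ring_scope.

Section CayleyGraph.
Variables (Gamma : groupType) (S : {fset Gamma}).

Definition symmetric_set : Prop := forall s, s \in S -> (s^-1)%g \in S.

(* For symmetric [S], the subgroup generated by [S] is the set of words
   over [S]. *)
Definition generating_set : Prop :=
  forall g : Gamma, exists w : seq Gamma,
    {subset w <= S} /\ g = (\prod_(s <- w) s)%g.

(* The Cayley graph is a simple graph on the vertex set [Gamma]: if the
   identity belongs to [S], it does not contribute a loop. *)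
Definition nbrs (x : Gamma) : {fset Gamma} :=
  [fset (x * s)%g | s in (S `\ 1%g)%fset]%fset.

(* For symmetric [S], adjacency is symmetric, so these are the vertices outside
   [W] with a neighbour in [W]. *)
Definition ext_boundary (W : {fset Gamma}) : {fset Gamma} :=
  ((\bigcup_(x <- W) nbrs x) `\` W)%fset.

Definition cheeger (R : realType) : R :=
  inf [set r : R | exists2 W : {fset Gamma}, W != fset0 &
         r = #|` ext_boundary W|%:R / #|` W|%:R].

Definition edges : set {fset Gamma} :=
  [set e | exists x y, y \in nbrs x /\ e = [fset x; y]%fset].

Lemma edges_mulP (g : Gamma) (e : {fset Gamma}) :
  edges e -> edges [fset (g * x)%g | x in e]%fset.
Proof.
move=> [x [y [yx ->]]]; case/imfsetP: yx => s sS ->.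
exists (g * x)%g, (g * (x * s))%g; split.
  by apply/imfsetP; exists s => //=; rewrite mulgA.
apply/fsetP => z; rewrite !inE; apply/imfsetP/idP => /=.
  by case=> u; rewrite !inE => uxy ->; case/orP: uxy => /eqP ->; rewrite eqxx ?orbT.
case/orP=> /eqP ->; [exists x | exists (x * s)%g] => //=; by rewrite !inE eqxx ?orbT.
Qed.

Definition edge_mul (g : Gamma) (e : edges) : edges :=
  SigSub (mem_set (edges_mulP g (set_valP e))).

End CayleyGraph.

(* [I -> T] with the product sigma-algebra. *)
Definition coord_preimages (I : Type) d (T : measurableType d) :
    set (set (I -> T)) :=
  [set A | exists i (B : set T),
     measurable B /\ A = (fun x : I -> T => x i) @^-1` B].

Definition prod_meas (I : Type) d (T : measurableType d) :=
  g_sigma_algebraType (@coord_preimages I d T).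

Definition config (Gamma : groupType) := prod_meas Gamma bool.

(* The action of [g] on configurations indexed by a set [I] on which [Gamma]
   acts through [act]: [(g . x) i = x (g^-1 . i)]. *)
Definition translate (Gamma : groupType) (I T : Type) (act : Gamma -> I -> I)
    (g : Gamma) (x : I -> T) : I -> T :=
  fun i => x (act (g^-1)%g i).

Definition vertex_mul (Gamma : groupType) (g v : Gamma) : Gamma := (g * v)%g.

Section Percolation.
Context (R : realType) (Gamma : groupType) (S : {fset Gamma}).

Section OneSpace.
Context d (T : measurableType d) (P : probability T R).

Definition site_percolation (X : T -> config Gamma) : Prop :=
  measurable_fun [set: T] X /\
  forall (g : Gamma) (A : set (config Gamma)), measurable A ->
    P [set w | A (translate (@vertex_mul Gamma) g (X w))] = P [set w | A (X w)].

Definition iid_uniform (I : choiceType) (U : I -> T -> R) : Prop :=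
  [/\ forall i, measurable_fun [set: T] (U i),
      forall i (B : set R), measurable B ->
        P (U i @^-1` B) = uniform_prob (@ltr01 R) B
    & forall (J : {fset I}) (B : I -> set R), (forall i, measurable (B i)) ->
        P [set w | forall i, i \in J -> B i (U i w)] =
        (\prod_(i <- J) P (U i @^-1` B i))%E].

(* The labels are almost surely in [0, 1]; the values of [F] on labellings
   which leave [0, 1] are irrelevant. *)
Definition factor_of_iid (I : choiceType) (act : Gamma -> I -> I)
    (X : T -> config Gamma) : Prop :=
  exists (U : I -> T -> R) (F : prod_meas I R -> config Gamma),
    [/\ iid_uniform U,
        measurable_fun [set: prod_meas I R] F,
        forall g u, F (translate act g u) = translate (@vertex_mul Gamma) g (F u)
      & forall w, X w = F (fun i => U i w)].

Definition fiid (X : T -> config Gamma) : Prop :=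
  factor_of_iid (@vertex_mul Gamma) X \/ factor_of_iid (@edge_mul Gamma S) X.

Definition percolation_degree (x : Gamma -> bool) (v : Gamma) : nat :=
  #|` [fset u in nbrs S v | x u]%fset|.

(* The elementary conditional expectation; meaningful when [P A] is nonzero. *)
Definition cond_expectation (Y : T -> R) (A : set T) : R :=
  (\int[P]_(w in A) Y w) / fine (P A).

End OneSpace.

(* The law of [X] is the limit, for weak convergence of measures on
   [{0,1}^Gamma] with the product topology, of laws of FIID percolations; the
   approximating percolations may live on different probability spaces. *)
Definition weak_fiid d (T : measurableType d) (P : probability T R)
    (X : T -> config Gamma) : Prop :=
  exists (d_ : nat -> measure_display) (T_ : forall n, measurableType (d_ n))
    (P_ : forall n, probability (T_ n) R)
    (X_ : forall n, T_ n -> config Gamma),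
    (forall n, site_percolation (P_ n) (X_ n) /\ fiid (P_ n) (X_ n)) /\
    forall f : prod_topology (fun _ : Gamma => bool) -> R,
      continuous f -> (exists M : R, forall x, `|f x| <= M) ->
      (\int[P_ n]_w f (X_ n w)) @[n --> \oo] --> (\int[P]_w f (X w)).

End Percolation.

(* Main.v *)
Require Import Defs.
From mathcomp Require Import all_boot all_order all_algebra finmap.
From mathcomp Require Import all_classical all_reals all_analysis.
From mathcomp Require Import ring lra.

Set Implicit Arguments.
Unset Strict Implicit.
Unset Printing Implicit Defensive.

Import Order.TTheory GRing.Theory Num.Theory.
Import numFieldNormedType.Exports.

Local Open Scope classical_set_scope.
Local Open Scope ring_scope.

(**
The correlations h(g) = Cov(X_1, X_g) of a percolation that is determined at
each vertex by finitely many i.i.d. labels form a finitely supported positive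
definite function on the group.  Let A be the lazy averaging operator over the
neighbours.  By Cheeger's inequality A contracts l^2 by a factor sqrt(rho) with
rho = 1 - gamma^2 / (16 d^2), hence |(A^k h)(1)| = O(rho^(k/2)).  Positive
definiteness makes k |-> (A^(2k) h)(1) log-convex, so this decay already holds
with constant 1: (A^2 h)(1) <= rho h(1).  Cauchy-Schwarz then gives a spectral
gap for A h, namely
  (1/d) sum_s P(X_1 = X_s = 1) - p^2 <= rho (p - p^2),    p = P(X_1 = 1),
which passes to all factors of i.i.d. by approximation in measure, and to weak
limits.  The degree assumption bounds the left-hand side below by
(1 - delta) p - p^2, so (1 - rho)(1 - p) <= delta.
*)

(** * Finitely supported real functions and their sums *)

Section FiniteSupport.
Variables (R : realType) (G : choiceType).
Implicit Types (f g : G -> R).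

Definition finitely_supported f := exists W : {fset G}, forall x, x \notin W -> f
  x = 0.

(** A sum with infinite support takes the default value 0, which is why additivity and monotonicity
    below carry finite support hypotheses. *)
Definition fsum f : R := \sum_(x \in [set: G]) f x.

Lemma fsumE (W : {fset G}) f :
  (forall x, x \notin W -> f x = 0) -> fsum f = \sum_(x <- W) f x.
Proof.
move=> fW; rewrite /fsum (fsbigE W)//=.
- by apply: eq_bigl => x; rewrite in_setT.
- by move=> x _ ; exact: fW.
Qed.

(** The operation is arbitrary so that one lemma serves all the linear, quadratic and absolute-value
    expressions in [f x] and [f (x * s)] met below. *)
Lemma finitely_supported_map2 (op : R -> R -> R) f g : op 0 0 = 0 ->
  finitely_supported f -> finitely_supported g ->
  finitely_supported (fun x => op (f x) (g x)).
Proof.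
move=> op0 [V fV] [W gW]; exists (V `|` W)%fset => x.
by rewrite inE negb_or => /andP[/fV -> /gW ->].
Qed.

Lemma finitely_supported_map (op : R -> R) f : op 0 = 0 ->
  finitely_supported f -> finitely_supported (fun x => op (f x)).
Proof. by move=> op0 [V fV]; exists V => x /fV ->. Qed.

Lemma finitely_supported_sum I (s : seq I) (F : I -> G -> R) :
  (forall i, finitely_supported (F i)) ->
  finitely_supported (fun x => \sum_(i <- s) F i x).
Proof.
move=> FF; elim: s => [|i s [W sW]].
  by exists fset0 => x _; rewrite big_nil.
have [V iV] := FF i; exists (V `|` W)%fset => x.
by rewrite inE negb_or => /andP[/iV iV0 /sW sW0]; rewrite big_cons iV0 sW0 addr0.
Qed.

Lemma finitely_supported_reindex (h k : G -> G) f : cancel h k ->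
  finitely_supported f -> finitely_supported (fun x => f (h x)).
Proof.
move=> hK [W fW]; exists [fset k x | x in W]%fset => x xW.
apply: fW; apply: contra xW => hW; apply/imfsetP; by exists (h x); rewrite //= hK.
Qed.

Lemma fsumD f g : finitely_supported f -> finitely_supported g ->
  fsum (fun x => f x + g x) = fsum f + fsum g.
Proof.
move=> [V fV] [W gW].
have fVW x : x \notin (V `|` W)%fset -> f x = 0.
  by rewrite inE negb_or => /andP[/fV].
have gVW x : x \notin (V `|` W)%fset -> g x = 0.
  by rewrite inE negb_or => /andP[_ /gW].
rewrite (fsumE fVW) (fsumE gVW) (@fsumE (V `|` W)%fset) ?big_split//.
by move=> x xVW; rewrite fVW// gVW// addr0.
Qed.

Lemma fsumZ (a : R) f : fsum (fun x => a * f x) = a * fsum f.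
Proof. by rewrite /fsum mulr_fsumr. Qed.

Lemma fsum_sum I (s : seq I) (F : I -> G -> R) :
  (forall i, finitely_supported (F i)) ->
  fsum (fun x => \sum_(i <- s) F i x) = \sum_(i <- s) fsum (F i).
Proof.
move=> FF; elim: s => [|i s IH].
  by rewrite big_nil (@fsumE fset0) ?big_seq_fset0// => x _; rewrite big_nil.
rewrite big_cons -IH -fsumD//; last exact: finitely_supported_sum.
by rewrite /fsum; apply: eq_fsbigr => x _; rewrite big_cons.
Qed.

Lemma le_fsum f g : finitely_supported f -> finitely_supported g ->
  (forall x, f x <= g x) -> fsum f <= fsum g.
Proof.
move=> [V fV] [W gW] fg.
have fVW x : x \notin (V `|` W)%fset -> f x = 0.
  by rewrite inE negb_or => /andP[/fV].
have gVW x : x \notin (V `|` W)%fset -> g x = 0.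
  by rewrite inE negb_or => /andP[_ /gW].
by rewrite (fsumE fVW) (fsumE gVW) ler_sum.
Qed.

Lemma eq_fsum f g : f =1 g -> fsum f = fsum g.
Proof. by move=> fg; apply: eq_fsbigr => x _; exact: fg. Qed.

Lemma fsum_reindex (h k : G -> G) f : cancel h k -> cancel k h ->
  fsum (fun x => f (h x)) = fsum f.
Proof. by move=> hK kK; rewrite /fsum [RHS](reindex_fsbigT h)//; exists k. Qed.

Lemma fsum_ge0 f : (forall x, 0 <= f x) -> 0 <= fsum f.
Proof. by move=> f0; apply: fsumr_ge0. Qed.

Lemma ge0_le_fsum f x : finitely_supported f -> (forall x, 0 <= f x) -> f x <=
  fsum f.
Proof.
move=> [W fW] f0; rewrite (fsumE fW).
have [xW|/fW ->] := boolP (x \in W); last exact: sumr_ge0.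
by rewrite (big_fsetD1 x)//= lerDl sumr_ge0.
Qed.

End FiniteSupport.

(** * From isoperimetry of finite sets to an $\ell^1$ gradient inequality *)

Lemma fset_argmin (R : realType) (G : choiceType) (W : {fset G}) (f : G -> R) :
  W != fset0 -> exists2 x, x \in W & forall y, y \in W -> f x <= f y.
Proof.
move=> /fset0Pn[x0 x0W].
case: (@Order.TotalTheory.arg_minP _ _ _ [` x0W]%fset xpredT (fun x : W => f (val
  x))) => // i _ imin.
by exists (val i); [exact: valP|move=> y yW; exact: (imin [` yW]%fset)].
Qed.

Section Isoperimetry.
Variables (R : realType) (G : groupType) (N : {fset G}) (c : R).
(** The right-hand side counts directed edges leaving [W]. For Cayley graphs, [c] will be the vertex
    Cheeger constant and [N] the neighbours of the identity. *)
Hypothesis isoperimetric : forall W : {fset G},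
  c * #|` W|%:R <= \sum_(s <- N) #|` [fset x in W | (x * s)%g \notin W]%fset|%:R.

Lemma finitely_supported_shift (f : G -> R) s : finitely_supported f ->
  finitely_supported (fun x => f (x * s)%g).
Proof. by apply: (@finitely_supported_reindex _ _ _ (fun x => x / s)%g);
  exact: mulgK. Qed.

Lemma fsum_shift (f : G -> R) s : fsum (fun x => f (x * s)%g) = fsum f.
Proof. by apply: (@fsum_reindex _ _ _ (fun x => x / s)%g);
  [exact: mulgK|exact: mulgVK]. Qed.

(* Layer cake: subtracting the minimum of [f] on its support [W] peels off a
   multiple of the indicator of [W], to which [isoperimetric] applies. *)
Lemma isoperimetric_l1 (f : G -> R) : finitely_supported f ->
  (forall x, 0 <= f x) ->
  c * fsum f <= \sum_(s <- N) fsum (fun x => `|f x - f (x * s)%g|).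
Proof.
move=> [W]; have [n] := ubnP #|` W|.
elim: n f W => // n IH f W Wn fW f0.
have [W0|W0] := eqVneq W fset0.
  rewrite (fsumE fW) W0 big_seq_fset0 mulr0 sumr_ge0// => s _.
  exact: fsum_ge0.
have [x0 x0W fmin] := fset_argmin f W0.
pose m := f x0.
(* Since [g] also vanishes at the minimiser [x0], its support fits in a set with one point fewer,
   and the induction on the size of the support applies. *)
pose g x := if x \in W then f x - m else 0.
have gW x : x \notin W -> g x = 0 by rewrite /g => /negbTE ->.
have gW' x : x \notin (W `\ x0)%fset -> g x = 0.
  rewrite !inE negb_and negbK => /orP[/eqP ->|]; last exact: gW.
  by rewrite /g x0W subrr.
have g0 x : 0 <= g x.
  by rewrite /g; case: ifPn => // xW; rewrite subr_ge0 fmin.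
have cg : c * fsum g <= \sum_(s <- N) fsum (fun x => `|g x - g (x * s)%g|).
  apply: (IH g (W `\ x0)%fset) => //.
  by move: Wn; rewrite (cardfsD1 x0 W) x0W.
have fE x : f x = g x + m * (x \in W)%:R.
  rewrite /g; case: ifPn => xW; first by rewrite mulr1 subrK.
  by rewrite mulr0 addr0 fW.
have finW : finitely_supported (fun x => (x \in W)%:R : R).
  by exists W => x /negbTE ->.
have fing : finitely_supported g by exists W.
have finf : finitely_supported f by exists W.
have sumW : fsum (fun x => (x \in W)%:R : R) = #|` W|%:R.
  rewrite (@fsumE _ _ W); last by move=> x /negbTE ->.
  rewrite card_fset_sum1 natr_sum big_seq [RHS]big_seq.
  by apply: eq_bigr => x ->.
have -> : fsum f = fsum g + m * #|` W|%:R.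
  rewrite -sumW -fsumZ -fsumD//; first exact: eq_fsum.
  by apply: (@finitely_supported_map _ _ ( *%R m)); rewrite ?mulr0.
rewrite mulrDr mulrCA.
apply: (le_trans (lerD cg (ler_wpM2l (f0 _ : 0 <= m) (isoperimetric W)))).
rewrite mulr_sumr -big_split/=; apply: ler_sum => s _.
have -> : #|` [fset x in W | (x * s)%g \notin W]%fset|%:R =
    fsum (fun x => ((x \in W) && ((x * s)%g \notin W))%:R : R).
  rewrite (@fsumE _ _ W); last by move=> x /negbTE ->.
  rewrite card_fset_sum1 -big_fset_condE/= natr_sum big_mkcond/=.
  rewrite big_seq [RHS]big_seq; apply: eq_bigr => x ->/=.
  by case: ifP.
rewrite -fsumZ.
have finabs (h : G -> R) : finitely_supported h ->
    finitely_supported (fun x => `|h x - h (x * s)%g|).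
  move=> finh; apply: (@finitely_supported_map2 _ _ (fun a b => `|a - b|)) => //.
    by rewrite subrr normr0.
  exact: finitely_supported_shift.
have finm : finitely_supported
    (fun x => m * ((x \in W) && ((x * s)%g \notin W))%:R).
  by exists W => x /negbTE ->; rewrite mulr0.
rewrite -fsumD//; last exact: finabs.
apply: le_fsum => [||x]; [|exact: finabs|].
  by apply: (@finitely_supported_map2 _ _ +%R) => //; [rewrite addr0|exact: finabs].
(* Pointwise comparison: inside [W] the constant [m] cancels, on an edge leaving [W] it is gained
   exactly, and on an edge entering [W] it only enlarges the right-hand side. *)
rewrite !fE; have m0 : 0 <= m by exact: f0.
have := g0 x; have := g0 (x * s)%g; have := gW x; have := gW (x * s)%g.
case: (x \in W); case: ((x * s)%g \in W) => /=; rewrite ?mulr1 ?mulr0 ?addr0.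
- by move=> _ _ _ _; rewrite opprD addrACA subrr addr0.
- by move=> -> // _ _ gx; rewrite !subr0 !ger0_norm// addr_ge0.
- move=> _ -> // gxs _; rewrite !sub0r !normrN !ger0_norm ?addr_ge0// lerDl//.
- by [].
Qed.

End Isoperimetry.

(** * Cheeger's inequality and the $\ell^2$ contraction of the lazy walk *)

Lemma sumr_const_seq (R : realType) (I : Type) (s : seq I) (a : R) :
  \sum_(i <- s) a = (size s)%:R * a.
Proof. by rewrite big_const_seq count_predT iter_addr_0 mulr_natl. Qed.

(** Cauchy-Schwarz against the constant 1, read off from the nonnegative sum of squared deviations
    from the mean [m]. *)
Lemma sqr_sum_le (R : realType) (I : Type) (s : seq I) (y : I -> R) :
  (\sum_(i <- s) y i) ^+ 2 <= (size s)%:R * \sum_(i <- s) y i ^+ 2.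
Proof.
have [/size0nil ->|n0] := eqVneq (size s) 0%N.
  by rewrite !big_nil expr0n/= mulr0.
have n0' : 0 < (size s)%:R :> R by rewrite ltr0n lt0n.
set Y := \sum_(i <- s) y i; pose m := Y / (size s)%:R.
have : 0 <= \sum_(i <- s) (y i - m) ^+ 2 by apply: sumr_ge0 => i _; exact: sqr_ge0.
have -> : \sum_(i <- s) (y i - m) ^+ 2 =
    \sum_(i <- s) y i ^+ 2 - 2 * m * Y + (size s)%:R * m ^+ 2.
  rewrite -sumr_const_seq mulr_sumr -sumrB -big_split/=.
  by apply: eq_bigr => i _; ring.
move=> h; rewrite -(ler_pM2l n0') mulr0 in h; apply: le_trans (_ : 0 + Y ^+ 2 <= _).
  by rewrite add0r.
rewrite -lerBrDr; apply: (le_trans h); rewrite le_eqVlt; apply/orP; left; apply/eqP.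
by rewrite /m; field; rewrite gt_eqF.
Qed.

Section LazyWalk.
Variables (R : realType) (G : groupType) (N : {fset G}).

(* Laziness keeps the spectrum away from -1 (bipartite Cayley graphs). *)
Definition lazy_average (f : G -> R) (x : G) : R :=
  f x / 2 + (\sum_(s <- N) f (x * s)%g) / (2 * #|` N|%:R).

Lemma finitely_supported_lazy_average f :
  finitely_supported f -> finitely_supported (lazy_average f).
Proof.
move=> finf; apply: (@finitely_supported_map2 _ _ (fun a b => a / 2 + b / (2 *
  #|` N|%:R)) f).
- by rewrite !mul0r addr0.
- by [].
- by apply: finitely_supported_sum => s; exact: finitely_supported_shift.
Qed.

Section Contraction.
Variable c : R.
Hypothesis c_gt0 : 0 < c.
Hypothesis N_gt0 : (0 < #|` N|)%N.
Hypothesis isoperimetric : forall W : {fset G},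
  c * #|` W|%:R <= \sum_(s <- N) #|` [fset x in W | (x * s)%g \notin W]%fset|%:R.

Let n : R := #|` N|%:R.

Let n_gt0 : 0 < n. Proof. by rewrite ltr0n. Qed.

Let finitely_supported_sqr (f : G -> R) : finitely_supported f ->
  finitely_supported (fun x => f x ^+ 2).
Proof. by apply: (@finitely_supported_map _ _ (fun a => a ^+ 2));
  rewrite expr0n. Qed.

Let finitely_supported_sqrB (f : G -> R) s : finitely_supported f ->
  finitely_supported (fun x => (f x - f (x * s)%g) ^+ 2).
Proof.
move=> finf; apply: (@finitely_supported_map2 _ _ (fun a b => (a - b) ^+ 2)) => //.
  by rewrite subrr expr0n.
exact: finitely_supported_shift.
Qed.

(** Cheeger's argument: apply the $\ell^1$ inequality to $f^2$, factor $|a^2-b^2|=|a-b||a+b|$, and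
    split this product by a weighted arithmetic-geometric mean inequality. *)
Lemma dirichlet_form_ge (f : G -> R) : finitely_supported f ->
  c ^+ 2 / (4 * n) * fsum (fun x => f x ^+ 2) <=
  \sum_(s <- N) fsum (fun x => (f x - f (x * s)%g) ^+ 2).
Proof.
move=> finf; set E := fsum _; set D := \sum_(s <- N) _.
have /(isoperimetric_l1 isoperimetric)/(_ (fun x => sqr_ge0 _)) :=
  finitely_supported_sqr finf.
rewrite -/E => l1.
(* The weights are tuned so that the error term is half of the left-hand side; it is absorbed, and
   multiplying by $c/(2n)$ gives the claim. *)
suff : c * E <= (2 * n / c) * D + (c / 2) * E.
  move=> h; have h' : (c / 2) * E <= (2 * n / c) * D by lra.
  have c2n : 0 < c / (2 * n) by rewrite divr_gt0// mulr_gt0.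
  rewrite -(ler_pM2l c2n) in h'.
  apply: le_trans (le_trans h' _).
    by rewrite le_eqVlt; apply/orP; left; apply/eqP; field; rewrite gt_eqF.
  by rewrite le_eqVlt; apply/orP; left; apply/eqP; field; rewrite !gt_eqF.
apply: (le_trans l1).
have -> : c / 2 * E = \sum_(s <- N) (c / (4 * n)) * (E + E).
  rewrite sumr_const_seq -/n.
  by field; rewrite gt_eqF.
rewrite mulr_sumr -big_split/=; apply: ler_sum => s _.
(* One copy of [E] is translated by [s], so that the inequality can be checked pointwise in [f x]
   and [f (x * s)]. *)
rewrite -[X in E + X](fsum_shift _ s).
have fs := finitely_supported_shift s (finitely_supported_sqr finf).
rewrite -fsumD//; last exact: finitely_supported_sqr.
rewrite -!fsumZ -fsumD; first apply: le_fsum.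
- apply: (@finitely_supported_map2 _ _ (fun a b => `|a - b|)) => //.
    by rewrite subrr normr0.
  exact: finitely_supported_sqr.
- apply: (@finitely_supported_map2 _ _ (fun a b => 2 * n / c * (a - b) ^+ 2 + c /
  (4 * n) * (a ^+ 2 + b ^+ 2)) f (fun x => f (x * s)%g)) => //.
    by rewrite subrr expr0n/= addr0 !mulr0 addr0.
  exact: finitely_supported_shift.
- move=> x; set a := f x; set b := f (x * s)%g.
  (* The goal is $|a^2-b^2| \le k(a-b)^2 + (a^2+b^2)/(2k)$. The squares [h1] and [h2] handle the two
     signs of $a^2-b^2$; [e3] is the parallelogram identity. *)
  pose k : R := 2 * n / c.
  have k0 : 0 < k by rewrite divr_gt0// mulr_gt0.
  have -> : c / (4 * n) = (2 * k)^-1 by rewrite /k; field; rewrite !gt_eqF.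
  rewrite -/k.
  have kV : 0 < (2 * k)^-1 by rewrite invr_gt0 mulr_gt0.
  have h1 : 0 <= (2 * k)^-1 * (2 * k * (a - b) - (a + b)) ^+ 2 by rewrite
    mulr_ge0 ?sqr_ge0// ltW.
  have h2 : 0 <= (2 * k)^-1 * (2 * k * (a - b) + (a + b)) ^+ 2 by rewrite
    mulr_ge0 ?sqr_ge0// ltW.
  have h3 : 0 <= (2 * k)^-1 * (a - b) ^+ 2 by rewrite mulr_ge0 ?sqr_ge0// ltW.
  have kk : (2 * k)^-1 * (2 * k) = 1 by rewrite mulVf// gt_eqF// mulr_gt0.
  have e1 : (2 * k)^-1 * (2 * k * (a - b) - (a + b)) ^+ 2 =
      2 * k * (a - b) ^+ 2 + (2 * k)^-1 * (a + b) ^+ 2 - 2 * (a ^+ 2 - b ^+ 2).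
    by field; rewrite gt_eqF.
  have e2 : (2 * k)^-1 * (2 * k * (a - b) + (a + b)) ^+ 2 =
      2 * k * (a - b) ^+ 2 + (2 * k)^-1 * (a + b) ^+ 2 + 2 * (a ^+ 2 - b ^+ 2).
    by field; rewrite gt_eqF.
  have e3 : (2 * k)^-1 * (a + b) ^+ 2 =
    2 * ((2 * k)^-1 * (a ^+ 2 + b ^+ 2)) - (2 * k)^-1 * (a - b) ^+ 2 by field;
      rewrite gt_eqF.
  rewrite e1 in h1; rewrite e2 in h2; rewrite ler_norml; lra.
- apply: (@finitely_supported_map _ _ ( *%R (2 * n / c))); first by rewrite mulr0.
  exact: finitely_supported_sqrB.
- apply: (@finitely_supported_map2 _ _ (fun a b => c / (4 * n) * (a + b))) => //.
    by rewrite addr0 mulr0.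
  exact: finitely_supported_sqr.
Qed.

(** The lazy average is the mean over [s] of the midpoints of [f x] and [f (x * s)]. Convexity of
    the square, summed over [x], gives $E - D/(4n)$, and Cheeger's inequality bounds $D$ from
    below. *)
Lemma lazy_average_contracts (f : G -> R) : finitely_supported f ->
  fsum (fun x => lazy_average f x ^+ 2) <=
  (1 - c ^+ 2 / (16 * n ^+ 2)) * fsum (fun x => f x ^+ 2).
Proof.
move=> finf; have := dirichlet_form_ge finf.
set E := fsum (fun x => f x ^+ 2); set D := \sum_(s <- N) _ => ED.
have -> : (1 - c ^+ 2 / (16 * n ^+ 2)) * E =
  E - (4 * n)^-1 * (c ^+ 2 / (4 * n) * E) by field; rewrite gt_eqF.
apply: le_trans (_ : E - (4 * n)^-1 * D <= _); last first.
  by rewrite lerD2l lerN2 ler_pM2l// invr_gt0 mulr_gt0.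
(* This is the squared midpoint divided by [n], written as $((a+b)/2)^2 = (a^2+b^2)/2 - (a-b)^2/4$
   to expose the Dirichlet form. *)
pose g s x := n^-1 * ((f x ^+ 2 + f (x * s)%g ^+ 2) / 2 - (f x - f (x * s)%g) ^+
  2 / 4).
have fing s : finitely_supported (g s).
  apply: (@finitely_supported_map2 _ _ (fun a b => n^-1 * ((a ^+ 2 + b ^+ 2) / 2
    - (a - b) ^+ 2 / 4))) => //.
    by rewrite subrr expr0n/= addr0 !mul0r subr0 mulr0.
  exact: finitely_supported_shift.
apply: (@le_trans _ _ (fsum (fun x => \sum_(s <- N) g s x))).
  apply: le_fsum => [||x].
  - by apply: finitely_supported_sqr; exact: finitely_supported_lazy_average.
  - exact: finitely_supported_sum.
  have -> : lazy_average f x = n^-1 * \sum_(s <- N) (f x + f (x * s)%g) / 2.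
    rewrite -mulr_suml big_split/= sumr_const_seq -/n.
    by rewrite /lazy_average -/n; field; rewrite gt_eqF.
  rewrite exprMn -mulr_sumr expr2 -mulrA ler_pM2l ?invr_gt0// ler_pdivrMl//.
  apply: (le_trans (sqr_sum_le _ _)); rewrite ler_pM2l//.
  by apply: ler_sum => s _; rewrite le_eqVlt; apply/orP; left; apply/eqP; field.
rewrite fsum_sum//.
have -> : E = \sum_(s <- N) n^-1 * E.
  rewrite sumr_const_seq -/n.
  by field; rewrite gt_eqF.
rewrite [_ * D]mulr_sumr -sumrB; apply: ler_sum => s _.
rewrite le_eqVlt; apply/orP; left; apply/eqP.
have fs := finitely_supported_sqr finf.
have fs' := finitely_supported_shift s fs.
rewrite /g fsumZ.
rewrite (@eq_fsum _ _ _ (fun x => 2^-1 * f x ^+ 2 +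
    (2^-1 * f (x * s)%g ^+ 2 + - 4^-1 * (f x - f (x * s)%g) ^+ 2)));
      last by move=> x; field.
rewrite !fsumD ?fsumZ.
- by rewrite (fsum_shift (fun x => f x ^+ 2)) -/E; field; rewrite gt_eqF.
- by apply: (@finitely_supported_map _ _ ( *%R _)) => //; rewrite mulr0.
- by apply: (@finitely_supported_map _ _ ( *%R _));
  [rewrite mulr0|exact: finitely_supported_sqrB].
- by apply: (@finitely_supported_map _ _ ( *%R _)) => //; rewrite mulr0.
- apply: (@finitely_supported_map2 _ _ (fun a b => 2^-1 * a + - 4^-1 * b)) => //.
    by rewrite !mulr0 addr0.
  exact: finitely_supported_sqrB.
Qed.
End Contraction.
End LazyWalk.

(** * Discriminants and log-convex sequences *)

Lemma discriminant_le (R : realType) (a b c : R) : 0 <= a -> 0 <= c ->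
  (forall t, 0 <= a + 2 * t * b + t ^+ 2 * c) -> b ^+ 2 <= a * c.
Proof.
move=> a0; rewrite le_eqVlt => /orP[/eqP <- h|c0 h].
  have [->|b0] := eqVneq b 0; first by rewrite expr0n mulr0.
  (* With no quadratic term, this [t] makes the affine function equal to $-1$. *)
  have := h (- (a + 1) / (2 * b)).
  have -> : a + 2 * (- (a + 1) / (2 * b)) * b + (- (a + 1) / (2 * b)) ^+ 2 * 0 = -1.
    by field.
  by rewrite lerNr oppr0 ler10.
have := h (- b / c); rewrite -(ler_pM2r c0) mul0r.
have -> : (a + 2 * (- b / c) * b + (- b / c) ^+ 2 * c) * c = a * c - b ^+ 2.
  by field; rewrite gt_eqF.
by rewrite subr_ge0.
Qed.

Lemma bernoulli_ge (R : realType) (x : R) k : 0 <= x -> 1 + k%:R * x <= (1 + x)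
  ^+ k.
Proof.
move=> x0; elim: k => [|k IH]; first by rewrite mul0r addr0 expr0.
rewrite exprS; apply: le_trans (_ : (1 + x) * (1 + k%:R * x) <= _); last first.
  by rewrite ler_wpM2l// addr_ge0.
have : 0 <= k%:R * x ^+ 2 by rewrite mulr_ge0 ?sqr_ge0.
by rewrite -natr1; lra.
Qed.

(* A log-convex sequence grows at least geometrically with ratio [a 1 / a 0]. *)
Lemma log_convex_ratio (R : realType) (a : nat -> R) (r C : R) : 0 < r ->
  (forall k, 0 <= a k) -> (forall k, a k.+1 ^+ 2 <= a k * a k.+2) ->
  (forall k, a k <= C * r ^+ k) -> a 1%N <= r * a 0%N.
Proof.
move=> r0 a_ge0 lc aC; rewrite leNgt; apply/negP => a1.
have a1_gt0 : 0 < a 1%N by apply: le_lt_trans a1; rewrite mulr_ge0// ltW.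
have a0_gt0 : 0 < a 0%N.
  rewrite lt_neqAle a_ge0 andbT; apply/eqP => a00.
  by have := lc 0%N; rewrite -a00 mul0r leNgt exprn_gt0.
pose q := a 1%N / a 0%N.
have q0 : 0 < q by rewrite divr_gt0.
(* Log-convexity keeps every successive ratio at least the first one, [q]; positivity is carried
   along to allow the cancellation. *)
have step k : 0 < a k /\ q * a k <= a k.+1.
  elim: k => [|k [ak qak]].
    by split=> //; rewrite /q divfK// gt_eqF.
  have ak1 : 0 < a k.+1 by apply: lt_le_trans qak; rewrite mulr_gt0.
  split=> //; rewrite -(ler_pM2l ak); apply: le_trans (lc k).
  by rewrite expr2 mulrCA mulrA ler_pM2r.
have geom k : a 0%N * q ^+ k <= a k.
  elim: k => [|k IH]; first by rewrite expr0 mulr1.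
  apply: le_trans (step k).2; rewrite exprS mulrCA ler_pM2l//.
(* If [q] exceeds [r], Bernoulli's inequality makes $(q/r)^k$ grow at least linearly in $k$, against
   the uniform bound [C]. *)
pose x := q / r - 1.
have x0 : 0 < x by rewrite subr_gt0 ltr_pdivlMr// mul1r /q ltr_pdivlMr.
have bound k : a 0%N * (1 + k%:R * x) <= C.
  apply: (@le_trans _ _ (a 0%N * (q / r) ^+ k)).
    rewrite ler_pM2l//; apply: (le_trans (bernoulli_ge k (ltW x0))).
    by rewrite /x addrC subrK.
  rewrite -(ler_pM2r (exprn_gt0 k r0)) -mulrA -exprMn divfK ?gt_eqF//.
  exact: le_trans (geom k) (aC k).
have ax0 : 0 < a 0%N * x by rewrite mulr_gt0.
have [k Ck] : exists k : nat, C / (a 0%N * x) < k%:R.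
  by exists (Num.truncn (C / (a 0%N * x))).+1; exact: truncnS_gt.
have := bound k; rewrite ltr_pdivrMr// in Ck; lra.
Qed.

(** * Positive definite functions under the lazy average *)

Section PositiveDefinite.
Variables (R : realType) (G : groupType) (N : {fset G}).

(** Finite families are lists of weighted points, repetitions allowed, so that concatenation adds
    formal combinations. *)
Definition positive_definite (h : G -> R) :=
  forall l : seq (R * G),
    0 <= \sum_(u <- l) \sum_(v <- l) u.1 * v.1 * h (u.2^-1 * v.2)%g.

Let A := @lazy_average R G N.

(** Each power of [A] is right convolution by one finite combination [l], independent of [f] and
    [x]; such lists can be fed to [positive_definite]. *)
Lemma iter_lazy_averageE n : exists l : seq (R * G),
  forall f x, iter n A f x = \sum_(u <- l) u.1 * f (x * u.2)%g.
Proof.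
elim: n => [|n [l IH]].
  by exists [:: (1, 1%g)] => f x; rewrite big_seq1/= mul1r mulg1.
exists ([seq (u.1 / 2, u.2) | u <- l] ++
  [seq (u.1 / (2 * #|` N|%:R), (s * u.2)%g) | s <- N, u <- l]) => f x.
rewrite iterS /A /lazy_average -/A IH big_cat/= big_map big_allpairs_dep/=.
congr (_ + _).
  by rewrite mulr_suml; apply: eq_bigr => u _; rewrite mulrAC.
rewrite mulr_suml; apply: eq_bigr => s _.
by rewrite IH mulr_suml; apply: eq_bigr => u _; rewrite mulgA mulrAC.
Qed.

Hypothesis N_sym : forall s, s \in N -> (s^-1)%g \in N.

Let left_average (f : G -> R) (x : G) : R :=
  f x / 2 + (\sum_(s <- N) f (s * x)%g) / (2 * #|` N|%:R).

Lemma sum_symmetric (f : G -> R) : \sum_(s <- N) f (s^-1)%g = \sum_(s <- N) f s.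
Proof.
have invN : [fset (s^-1)%g | s in N]%fset = N.
  apply/fsetP => s; apply/imfsetP/idP => [[t /= tN ->]|sN]; first exact: N_sym.
  by exists (s^-1)%g; rewrite ?invgK//; exact: N_sym.
rewrite -[in RHS]invN big_imfset//= => s t _ _; exact: invg_inj.
Qed.

Let averageV f : A (fun x => f (x^-1)%g) =1 (fun x => left_average f (x^-1)%g).
Proof.
move=> x; rewrite /A /lazy_average /left_average -(sum_symmetric (fun s => f (s *
  x^-1)%g)).
by congr (_ + _ / _); apply: eq_bigr => s _; rewrite invgM.
Qed.

Let averageC f : A (left_average f) =1 left_average (A f).
Proof.
move=> x; rewrite /A /lazy_average /left_average.
have -> : \sum_(s <- N) (f (x * s)%g / 2 + (\sum_(t <- N) f (t * (x * s))%g) / (2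
  * #|` N|%:R)) =
    (\sum_(s <- N) f (x * s)%g) / 2 + (\sum_(t <- N) \sum_(s <- N) f (t * x *
      s)%g) / (2 * #|` N|%:R).
  rewrite big_split/= -!mulr_suml [in RHS]exchange_big/=.
  by congr (_ + _ / _); apply: eq_bigr => s _; apply: eq_bigr => t _; rewrite mulgA.
have -> : \sum_(s <- N) (f (s * x)%g / 2 + (\sum_(t <- N) f (s * x * t)%g) / (2 *
  #|` N|%:R)) =
    (\sum_(s <- N) f (s * x)%g) / 2 + (\sum_(t <- N) \sum_(s <- N) f (t * x *
      s)%g) / (2 * #|` N|%:R).
  by rewrite big_split/= -!mulr_suml.
ring.
Qed.

(** Inversion conjugates [A] into the left average, by symmetry of [N]. The left average commutes
    with [A] and agrees with it at the identity, so their powers agree there as well. *)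
Lemma iter_averageV n f :
  iter n A (fun x => f (x^-1)%g) 1%g = iter n A f 1%g.
Proof.
have iterV m : iter m A (fun x => f (x^-1)%g) = (fun x => iter m left_average f
  (x^-1)%g).
  by elim: m => //= m ->; apply/funext; exact: averageV.
rewrite iterV invg1 {iterV}; elim: n f => // n IH f.
have commute m g : iter m left_average (A g) = A (iter m left_average g).
  by elim: m => //= m ->; apply/funext => x; rewrite averageC.
rewrite (iterSr n A f) -IH commute/= /left_average /A /lazy_average.
by congr (_ + _ / _); apply: eq_bigr => s _; rewrite mulg1 mul1g.
Qed.

(** The kernel of [h] defines a positive semidefinite form on finite combinations. On the
    combinations of $A^m$ and $A^n$ it takes the value $(A^{m+n}h)(1)$, so this is
    Cauchy-Schwarz. *)
Lemma iter_average_log_convex h m n : positive_definite h ->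
  0 <= iter (m + m) A h 1%g /\
  iter (m + n) A h 1%g ^+ 2 <= iter (m + m) A h 1%g * iter (n + n) A h 1%g.
Proof.
move=> pd.
pose B (k l : seq (R * G)) := \sum_(u <- k) \sum_(v <- l) u.1 * v.1 * h (u.2^-1 *
  v.2)%g.
pose E i (l : seq (R * G)) := forall f x, iter i A f x = \sum_(u <- l) u.1 * f (x
  * u.2)%g.
(* Inverting the argument of the outer iterate turns evaluation at [u.2] into evaluation at its
   inverse, as the kernel requires. *)
have BE i j k l : E i k -> E j l -> B k l = iter (i + j) A h 1%g.
  move=> Ek El; rewrite iterD -iter_averageV Ek; apply: eq_bigr => u _.
  rewrite mul1g El mulr_sumr; apply: eq_bigr => v _; by rewrite mulrA.
have [k Ek] := iter_lazy_averageE m.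
have [l El] := iter_lazy_averageE n.
rewrite -(BE _ _ _ _ Ek Ek) -(BE _ _ _ _ El El) -(BE _ _ _ _ Ek El).
split; first exact: pd.
apply: discriminant_le => [||t]; [exact: pd|exact: pd|].
(* This list represents the combination $k + t\,l$; expanding gives the quadratic polynomial in
   [t]. *)
have := pd (k ++ [seq (t * u.1, u.2) | u <- l]).
rewrite big_cat/= big_map/=.
under eq_bigr do rewrite big_cat/= big_map/=.
under [X in _ + X]eq_bigr do rewrite big_cat/= big_map/=.
rewrite !big_split/= -/(B k k).
have -> : \sum_(u <- k) \sum_(v <- l) u.1 * (t * v.1) * h (u.2^-1 * v.2)%g = t *
  B k l.
  rewrite mulr_sumr; apply: eq_bigr => u _; rewrite mulr_sumr;
    apply: eq_bigr => v _; ring.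
have -> : \sum_(u <- l) \sum_(v <- k) t * u.1 * v.1 * h (u.2^-1 * v.2)%g = t * B
  l k.
  rewrite mulr_sumr; apply: eq_bigr => u _; rewrite mulr_sumr;
    apply: eq_bigr => v _; ring.
have -> : \sum_(u <- l) \sum_(v <- l) t * u.1 * (t * v.1) * h (u.2^-1 * v.2)%g =
  t ^+ 2 * B l l.
  rewrite mulr_sumr; apply: eq_bigr => u _; rewrite mulr_sumr;
    apply: eq_bigr => v _; ring.
have -> : B l k = B k l by rewrite (BE _ _ _ _ Ek El) (BE _ _ _ _ El Ek) addnC.
by move=> h0; apply: (le_trans h0); rewrite le_eqVlt; apply/orP; left; apply/eqP;
  ring.
Qed.

Section Spectral.
Variable c : R.
Hypothesis c_gt0 : 0 < c.
Hypothesis N_gt0 : (0 < #|` N|)%N.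
Hypothesis isoperimetric : forall W : {fset G},
  c * #|` W|%:R <= \sum_(s <- N) #|` [fset x in W | (x * s)%g \notin W]%fset|%:R.

Let n : R := #|` N|%:R.
Let n_gt0 : 0 < n. Proof. by rewrite ltr0n. Qed.
(** Bounds the square of the $\ell^2$ norm of [A] on finitely supported functions, so it governs two
    steps of the lazy walk. *)
Let rho : R := 1 - c ^+ 2 / (16 * n ^+ 2).

(** Testing the isoperimetric inequality on a singleton gives $c \le n$. *)
Lemma spectral_radius_gt0 : 0 < rho.
Proof.
have cn : c <= n.
  have := isoperimetric [fset 1%g]%fset; rewrite cardfs1 mulr1 => /le_trans; apply.
  apply: (@le_trans _ _ (\sum_(s <- N) 1)); last by rewrite sumr_const_seq mulr1.
  apply: ler_sum => s _;
    rewrite -[leRHS]/(1%:R) ler_nat -[leqRHS](cardfs1 (1%g : G)).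
  by apply: fsubset_leq_card; apply/fsubsetP => x; rewrite !inE => /andP[].
rewrite /rho subr_gt0 ltr_pdivrMr ?mul1r; last by rewrite mulr_gt0// exprn_gt0.
apply: (@le_lt_trans _ _ (n ^+ 2)); last by rewrite -subr_gt0;
  have := exprn_gt0 2 n_gt0; lra.
by rewrite ler_pXn2r// nnegrE ltW.
Qed.

Lemma fsum_iter_average_le h m : finitely_supported h ->
  finitely_supported (iter m A h) /\
  fsum (fun x => iter m A h x ^+ 2) <= rho ^+ m * fsum (fun x => h x ^+ 2).
Proof.
move=> finh; elim: m => [|m [finm IH]]; first by rewrite expr0 mul1r.
split; first exact: finitely_supported_lazy_average.
rewrite iterS;
  apply: (le_trans (lazy_average_contracts c_gt0 N_gt0 isoperimetric finm)).
rewrite -/n -/rho exprS -mulrA; apply: ler_wpM2l => //;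
  exact/ltW/spectral_radius_gt0.
Qed.

(** With $b_k = (A^k h)(1)$, the even terms are log-convex and decay like $\rho^k$, so $b_2 \le \rho
    b_0$. Then $b_1^2 \le b_0 b_2$ bounds $b_1$, and removing the laziness gives the plain
    average. *)
Lemma positive_definite_average_le h : positive_definite h -> finitely_supported
  h ->
  (\sum_(s <- N) h s) / n <= rho * h 1%g.
Proof.
move=> pd finh; set b := fun k => iter k A h 1%g.
have rho0 := spectral_radius_gt0.
pose E := fsum (fun x => h x ^+ 2).
have E0 : 0 <= E by apply: fsum_ge0 => x; exact: sqr_ge0.
have b0 k : 0 <= b (k + k)%N := (iter_average_log_convex k k pd).1.
have : b 2%N <= rho * b 0%N.
  (* The constant [1 + E] replaces $\sqrt E$. Log-convexity of the even terms uses the pair [k],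
     [k.+2], whose sum is twice [k.+1]. *)
  apply: (@log_convex_ratio _ (fun k => b (k + k)%N) rho (1 + E)) => // k.
    have := (iter_average_log_convex k k.+2 pd).2.
    by rewrite -/(b _) -/(b _) -/(b _) addnS -addSnnS -addnS.
  have finsq (f : G -> R) : finitely_supported f -> finitely_supported (fun x =>
    f x ^+ 2).
    by apply: (@finitely_supported_map _ _ (fun a => a ^+ 2)); rewrite expr0n.
  have [fink le_k] := fsum_iter_average_le (k + k) finh.
  have := ge0_le_fsum 1%g (finsq _ fink) (fun x => sqr_ge0 _).
  rewrite -/(b _) => /le_trans/(_ le_k); rewrite -/E exprD -expr2 => bE.
  rewrite -(@ler_pXn2r _ 2)// ?nnegrE//; last first.
    by rewrite mulr_ge0 ?addr_ge0// ?exprn_ge0 ?ltW.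
  apply: (le_trans bE); rewrite exprMn mulrC ler_wpM2r ?sqr_ge0//.
  by rewrite sqrrD expr1n mul1r; have := sqr_ge0 E; lra.
have := (iter_average_log_convex 0 1 pd).2; rewrite -/(b 0%N) -/(b 1%N) -/(b 2%N).
move=> b1 b2.
(* This uses $\sqrt\rho \le (1+\rho)/2$ in squared form. The weaker ratio loses nothing at the end:
   $b_1$ is half of [h 1] plus half of the plain average, which cancels the $1/2$. *)
have {b1 b2} b1 : b 1%N <= (1 + rho) / 2 * b 0%N.
  have b00 : 0 <= b 0%N := b0 0%N.
  have [//|lt1] := leP (b 1%N) _; exfalso.
  have r1 : 0 <= (1 + rho) / 2 * b 0%N by rewrite mulr_ge0// divr_ge0//
    addr_ge0// ltW.
  have : ((1 + rho) / 2 * b 0%N) ^+ 2 < b 1%N ^+ 2 by rewrite ltr_pXn2r//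
    ?nnegrE// (le_trans r1)// ltW.
  apply/negP; rewrite -leNgt; apply: (le_trans b1).
  apply: (le_trans (ler_wpM2l b00 b2)).
  rewrite -subr_ge0.
  have -> : ((1 + rho) / 2 * b 0%N) ^+ 2 - b 0%N * (rho * b 0%N) = ((1 - rho) / 2
    * b 0%N) ^+ 2 by field.
  exact: sqr_ge0.
move: b1; rewrite /b/= /A /lazy_average -/n.
have -> : \sum_(s <- N) h (1 * s)%g = \sum_(s <- N) h s.
  by apply: eq_bigr => s _; rewrite mul1g.
set S := \sum_(s <- N) _ => b1.
have Sn : S / (2 * n) = (S / n) / 2 by field; rewrite gt_eqF.
rewrite Sn in b1.
lra.
Qed.

End Spectral.
End PositiveDefinite.

(** * Covariances, and extension from generating families of events *)

Section ProbabilityFacts.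
Context (R : realType) d (T : measurableType d) (P : probability T R).

Lemma Pr_fin (E : set T) : measurable E -> P E \is a fin_num.
Proof. by move=> mE; rewrite fin_num_measure. Qed.

Lemma sum_indic_Rintegral (l : seq (R * set T)) :
  (forall u, u \in l -> measurable u.2) ->
  P.-integrable setT (EFin \o (fun w => \sum_(u <- l) u.1 * \1_(u.2) w)) /\
  \int[P]_w (\sum_(u <- l) u.1 * \1_(u.2) w) = \sum_(u <- l) u.1 * fine (P u.2).
Proof.
elim: l => [|u l IH] ml.
  rewrite big_nil; split.
    apply: (eq_integrable (mu:=P) _ (cst 0%E)) => //; last exact: integrable0.
    by move=> w _ /=; rewrite big_nil.
  by under eq_Rintegral do rewrite big_nil; rewrite Rintegral_cst// mul0r.
have mu : measurable u.2 by apply: ml; rewrite mem_head.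
have [|il El] := IH; first by move=> v vl; apply: ml; rewrite inE vl orbT.
have iu : P.-integrable setT (EFin \o (\1_(u.2) : T -> R)).
  apply: integrable_indic => //.
have iau : P.-integrable setT (EFin \o (fun w => u.1 * \1_(u.2) w)).
  by have := integrableZl measurableT u.1 iu.
split.
  have := integrableD measurableT iau il.
  by apply: eq_integrable => // w _ /=; rewrite big_cons.
rewrite big_cons -El; under eq_Rintegral do rewrite big_cons.
rewrite RintegralD// RintegralZl//; congr (_ * _ + _).
by rewrite /Rintegral integral_indic// setIT.
Qed.

(** The double sum is the expectation of the square of a weighted sum of indicators. *)
Lemma second_moment_ge0 (l : seq (R * set T)) :
  (forall u, u \in l -> measurable u.2) ->
  0 <= \sum_(u <- l) \sum_(v <- l) u.1 * v.1 * fine (P (u.2 `&` v.2)).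
Proof.
move=> ml; pose k := [seq (u.1 * v.1, u.2 `&` v.2) | u <- l, v <- l].
have mk u : u \in k -> measurable u.2.
  by case/allpairsP => -[a b] /= [al bl ->]; apply: measurableI; exact: ml.
have := (sum_indic_Rintegral mk).2; rewrite big_allpairs_dep/= => <-.
apply: Rintegral_ge0 => w _.
rewrite big_allpairs_dep/=.
rewrite (_ : \sum_(_ <- _) _ = (\sum_(u <- l) u.1 * \1_(u.2) w) ^+ 2) ?sqr_ge0//.
rewrite expr2 mulr_suml; apply: eq_bigr => u _; rewrite mulr_sumr;
  apply: eq_bigr => v _.
by rewrite indicI mulrACA.
Qed.

Lemma covariance_psd (l : seq (R * set T)) (p : R) :
  (forall u, u \in l -> measurable u.2 /\ fine (P u.2) = p) ->
  0 <= \sum_(u <- l) \sum_(v <- l) u.1 * v.1 * (fine (P (u.2 `&` v.2)) - p ^+ 2).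
Proof.
move=> lp; pose m := \sum_(u <- l) u.1 * p.
(* Adding the sure event with weight [- m] centres the sum, turning the second moment into a
   variance. *)
have /second_moment_ge0 : forall u, u \in (- m, setT) :: l -> measurable u.2.
  move=> u; rewrite inE => /orP[/eqP ->|/lp[]//].
  exact: measurableT.
have Ep : \sum_(u <- l) u.1 * fine (P u.2) = m.
  by rewrite big_seq [RHS]big_seq; apply: eq_bigr => u /lp[_ ->].
rewrite big_cons big_cons/= setIT probability_setT/= mulr1.
rewrite (_ : \sum_(u <- l) - m * _ * _ = - m * m); last first.
  rewrite -[X in _ = _ * X]Ep mulr_sumr; apply: eq_bigr => u _;
    by rewrite setTI mulrA.
rewrite (_ : \sum_(u <- l) _ = - m * m + \sum_(u <- l) \sum_(v <- l) u.1 * v.1 *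
  fine (P (u.2 `&` v.2))); last first.
  rewrite -[X in _ = _ * X + _]Ep mulr_sumr -big_split/=; apply: eq_bigr => u _.
  by rewrite big_cons/= setIT; congr (_ + _); ring.
move=> h; apply: (le_trans h).
rewrite [leRHS](_ : _ = \sum_(u <- l) \sum_(v <- l) u.1 * v.1 * fine (P (u.2 `&`
  v.2)) - m ^+ 2).
  by rewrite le_eqVlt; apply/orP; left; apply/eqP; ring.
rewrite [m ^+ 2]expr2 {1}/m mulr_suml -sumrB; apply: eq_bigr => u _.
rewrite /m mulr_sumr -sumrB; apply: eq_bigr => v _; ring.
Qed.

(** The pi-lambda argument for two image measures. [X] carries no sigma-algebra, so measurability of
    preimages is proved along with equality; the equal finite total masses handle complements. *)
Lemma pi_lambda_eq (X : Type) (G : set (set X)) (m1 m2 : {measure set T -> \bar R})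
    (phi psi : T -> X) : setI_closed G ->
  (m1 setT < +oo)%E -> m1 setT = m2 setT ->
  (forall C, G C -> [/\ measurable (phi @^-1` C), measurable (psi @^-1` C) &
     m1 (phi @^-1` C) = m2 (psi @^-1` C)]) ->
  forall C, <<s G >> C -> [/\ measurable (phi @^-1` C), measurable (psi @^-1` C) &
     m1 (phi @^-1` C) = m2 (psi @^-1` C)].
Proof.
move=> GI m1oo m12 GE.
pose Q : set (set X) := [set C | [/\ measurable (phi @^-1` C), measurable (psi
  @^-1` C) &
     m1 (phi @^-1` C) = m2 (psi @^-1` C)]].
have : <<s G >> `<=` Q; last by [].
rewrite -setI_closed_g_dynkin_g_sigma_algebra//; apply: smallest_sub => //.
split=> [|C [mp mq e]|F tF QF].
- by split; rewrite ?preimage_setT.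
- rewrite /Q/= -!preimage_setC; split; [exact: measurableC|exact: measurableC|].
  have setC_sub (m : {measure set T -> \bar R}) B : (m setT < +oo)%E ->
    measurable B ->
      m (~` B) = (m setT - m B)%E.
    by move=> moo mB; rewrite -setTD measureD// setTI.
  by rewrite !setC_sub// -?m12// e.
- rewrite /Q/= !preimage_bigcup; split.
  + by apply: bigcupT_measurable => n; have [] := QF n.
  + by apply: bigcupT_measurable => n; have [] := QF n.
  + have trivF (f : T -> X) : trivIset setT (fun n => f @^-1` F n).
      by move=> i j _ _ [w [Fi Fj]]; apply: tF => //; exists (f w).
    rewrite (measure_bigcup m1); [|by move=> n _; have [] := QF n|exact: trivF].
    rewrite (measure_bigcup m2); [|by move=> n _; have [] := QF n|exact: trivF].
    by apply: eq_eseriesr => n _; have [] := QF n.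
Qed.

(** Independence of [E] is equality of two finite measures, [P] restricted to [E] and [P] scaled by
    the probability of [E]. *)
Lemma independent_extend (X : Type) (G : set (set X)) (phi : T -> X) (E : set T) :
  setI_closed G -> measurable E ->
  (forall C, G C -> measurable (phi @^-1` C) /\
     P (phi @^-1` C `&` E) = (P (phi @^-1` C) * P E)%E) ->
  forall C, <<s G >> C -> measurable (phi @^-1` C) /\
     P (phi @^-1` C `&` E) = (P (phi @^-1` C) * P E)%E.
Proof.
move=> GI mE GE C GC.
have PE0 : 0 <= fine (P E) by rewrite fine_ge0.
have PEE : P E = (fine (P E))%:E by rewrite fineK// Pr_fin.
have [||C' GC'|//|mp _] := @pi_lambda_eq X G (mrestr P mE) (mscale (NngNum PE0)
  P) phi phi GI _ _ _ C.
- by rewrite /= /mrestr setTI (le_lt_trans (probability_le1 _ _))// ltry.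
- by rewrite /= /mrestr setTI/mscale/= probability_setT mule1.
- have [mC' e] := GE _ GC'; split=> //.
  by rewrite /= /mrestr /mscale/= e [in LHS]PEE muleC.
by rewrite /= /mrestr /mscale/= => e; split=> //; rewrite e -PEE muleC.
Qed.

End ProbabilityFacts.

(** * Events that depend on a given set of labels *)

Section Rectangles.
Variables (R : realType) (I : choiceType).
Implicit Types D : set I.

(** The sigma-algebra generated by these boxes encodes dependence on the labels in [D] alone, while
    its members remain sets of full labellings. *)
Definition rectangle D : set (set (I -> R)) :=
  [set A | exists (J : {fset I}) (B : I -> set R),
     [/\ [set` J] `<=` D, forall i, measurable (B i) &
         A = [set u | forall i, i \in J -> B i (u i)]]].

Lemma rectangle_setI_closed D : setI_closed (rectangle D).
Proof.
move=> _ _ [J [B [JD mB ->]]] [K [C [KD mC ->]]].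
exists (J `|` K)%fset, (fun i => (if i \in J then B i else setT) `&`
  (if i \in K then C i else setT)); split.
- by move=> i /=; rewrite inE => /orP[/JD|/KD].
- by move=> i; apply: measurableI; case: ifP.
- apply/seteqP; split=> u /=.
    by move=> [uB uC] i _; split; case: ifP => // iJ; [exact: uB|exact: uC].
  move=> h; split=> i iJ.
    by have := h i; rewrite inE iJ => /(_ isT)[].
  by have := h i; rewrite inE iJ orbT => /(_ isT)[].
Qed.

Lemma rectangle_sub D D' : D `<=` D' -> rectangle D `<=` rectangle D'.
Proof.
by move=> DD' _ [J [B [JD mB ->]]]; exists J, B; split=> //;
  exact: subset_trans DD'.
Qed.

Lemma g_sigma_rectangle_sub D D' : D `<=` D' ->
  <<s rectangle D>> `<=` <<s rectangle D'>>.
Proof. by move=> DD'; apply: sub_sigma_algebra2; exact: rectangle_sub. Qed.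

Lemma measurable_rectangleT (A : set (prod_meas I R)) :
  measurable A -> <<s rectangle setT>> A.
Proof.
apply: sub_sigma_algebra2 => _ [i [B [mB ->]]].
exists [fset i]%fset, (fun=> B); split=> //.
apply/seteqP; split=> u /=; last by apply; rewrite inE.
by move=> Bu j; rewrite inE => /eqP ->.
Qed.

(** Locates a translated event on the translated labels, so that disjointness of label sets can
    yield independence. *)
Lemma g_sigma_rectangle_shift D (sigma : I -> I) (C : set (I -> R)) :
  <<s rectangle D>> C -> injective sigma ->
  <<s rectangle (sigma @` D)>> [set u | C (fun i => u (sigma i))].
Proof.
move=> DC sigma_inj.
pose Q := [set C : set (I -> R) |
  <<s rectangle (sigma @` D)>> [set u | C (fun i => u (sigma i))]].
suff : <<s rectangle D>> `<=` Q by apply.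
have [s0 sC sU] : sigma_algebra setT <<s rectangle (sigma @` D)>>.
  exact: smallest_sigma_algebra.
apply: smallest_sub.
  split=> [|B QB|F QF].
  - exact: s0.
  - exact: sC QB.
  - rewrite /Q/=; have := sU _ QF.
    by congr (smallest _ _ _); apply/seteqP; split.
move=> _ [J [B [JD mB ->]]]; apply: sub_sigma_algebra.
exists [fset sigma i | i in J]%fset.
(* The constraint at [j] comes from its preimages in [J]: at most one by injectivity, and none
   leaves the whole line. *)
exists (fun j => [set r | forall i, sigma i = j -> i \in J -> B i r]); split.
- by move=> _ /imfsetP[i /= iJ ->]; exists i => //; exact: JD.
- move=> j; have [[i ij]|nij] := pselect (exists i, sigma i = j).
    rewrite (_ : mkset _ = if i \in J then B i else setT); first by case: ifP.
    apply/seteqP; split=> r /=; first by move=> h; case: ifP => // iJ; exact: h.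
    by move=> h k; rewrite -ij => /sigma_inj -> iJ; move: h; rewrite iJ.
  rewrite (_ : mkset _ = setT)//; apply/seteqP; split=> r //= _ i ij.
  by exfalso; apply: nij; exists i.
- apply/seteqP; split=> u /=.
    by move=> h _ /imfsetP[i /= iJ ->] k /sigma_inj -> kJ; exact: h.
  by move=> h i iJ; apply: (h (sigma i)) => //; apply/imfsetP; exists i.
Qed.

End Rectangles.

(** * Invariance, independence and finite approximation for i.i.d. labels *)

Section Labels.
Context (R : realType) d (T : measurableType d) (P : probability T R).
Variables (I : choiceType) (U : I -> T -> R).
Hypothesis iidU : iid_uniform P U.

Definition labelling (sigma : I -> I) (w : T) : I -> R := fun i => U (sigma i) w.

Lemma labelling_rectangle D sigma A : rectangle D A ->
  measurable (labelling sigma @^-1` A).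
Proof.
case: iidU => mU _ _ [J [B [_ mB ->]]].
rewrite (_ : _ @^-1` _ = \bigcap_(i in [set` J]) (U (sigma i) @^-1` B i)).
  by apply: fin_bigcap_measurable => // i _; rewrite -[X in measurable X]setTI;
    exact: mU.
by apply/seteqP; split.
Qed.

(** On boxes both sides are the same product of uniform probabilities, reindexed along [sigma]; the
    pi-lambda argument does the rest. *)
Lemma labelling_law (sigma tau : I -> I) A : cancel sigma tau ->
  <<s rectangle setT>> A ->
  [/\ measurable (labelling sigma @^-1` A), measurable (labelling id @^-1` A) &
    P (labelling sigma @^-1` A) = P (labelling id @^-1` A)].
Proof.
move=> sigmaK; apply: (@pi_lambda_eq _ _ _ _ _ P P).
- exact: rectangle_setI_closed.
- by apply: (@le_lt_trans _ _ 1%E); [exact: probability_le1|exact: ltry].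
- by [].
move=> C RC; split; [exact: labelling_rectangle RC|exact: labelling_rectangle RC|].
suff : P (labelling sigma @^-1` C) = P (labelling id @^-1` C) by [].
case: iidU RC => mU unifU indU [J [B [_ mB ->]]].
rewrite (_ : labelling sigma @^-1` _ =
    [set w | forall j, j \in [fset sigma i | i in J]%fset -> B (tau j) (U j w)]).
  rewrite (indU _ (fun j => B (tau j))); last by move=> j; exact: mB.
  rewrite (_ : labelling id @^-1` _ = [set w | forall i, i \in J -> B i (U i
    w)])// indU//.
  rewrite big_imfset/=; last by move=> x y _ _; exact: (can_inj sigmaK).
  by apply: eq_bigr => i _; rewrite sigmaK !unifU.
apply/seteqP; split=> w /=.
  by move=> h _ /imfsetP[i /= iJ ->]; rewrite sigmaK; exact: h.
move=> h i iJ; have := h (sigma i); rewrite sigmaK; apply.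
by apply/imfsetP; exists i.
Qed.

Lemma rectangle_independent D D' A B : D `&` D' = set0 ->
  rectangle D A -> rectangle D' B ->
  P (labelling id @^-1` A `&` labelling id @^-1` B) =
    (P (labelling id @^-1` A) * P (labelling id @^-1` B))%E.
Proof.
case: iidU => mU _ indU DD' [J [B1 [JD mB1 ->]]] [K [B2 [KD mB2 ->]]].
have JK i : i \in J -> i \in K -> False.
  move=> iJ iK; have : (D `&` D') i by split; [exact: JD|exact: KD].
  by rewrite DD'.
rewrite (_ : labelling id @^-1` _ = [set w | forall i, i \in J -> B1 i (U i w)])//.
rewrite (_ : labelling id @^-1` _ = [set w | forall i, i \in K -> B2 i (U i w)])//.
pose B0 i := if i \in J then B1 i else B2 i.
rewrite (_ : _ `&` _ = [set w | forall i, i \in (J `|` K)%fset -> B0 i (U i w)]).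
  rewrite !indU//; last by move=> i; rewrite /B0; case: ifP.
  rewrite (perm_big (enum_fset J ++ enum_fset K))/=; last first.
    apply: uniq_perm; rewrite ?cat_uniq ?fset_uniq//= ?andbT.
      by apply/hasPn => i iK; apply/negP => iJ; exact: JK iJ iK.
    by move=> i; rewrite mem_cat inE.
  rewrite big_cat/=.
  congr (_ * _)%E.
    by rewrite big_seq [RHS]big_seq; apply: eq_bigr => i iJ; rewrite /B0 iJ.
  rewrite big_seq [RHS]big_seq; apply: eq_bigr => i iK; rewrite /B0 ifN//.
  by apply/negP => /JK; exact.
apply/seteqP; split=> w /=.
  move=> [h1 h2] i; rewrite inE /B0; case: ifPn => iJ; first by move=> _; exact: h1.
  exact: h2.
move=> h; split=> i iJ.
  by have := h i; rewrite inE /B0 iJ; exact.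
have := h i; rewrite inE /B0 iJ orbT => /(_ isT); case: ifPn => // iJ'.
by exfalso; exact: JK iJ' iJ.
Qed.

(** Boxes are replaced by general events one side at a time, each time with the other event
    fixed. *)
Lemma labelling_independent D D' A B : D `&` D' = set0 ->
  <<s rectangle D>> A -> <<s rectangle D'>> B ->
  P (labelling id @^-1` A `&` labelling id @^-1` B) =
    (P (labelling id @^-1` A) * P (labelling id @^-1` B))%E.
Proof.
move=> DD' DA DB.
have mA : measurable (labelling id @^-1` A).
  by have [] := @labelling_law id id A _ (g_sigma_rectangle_sub (@subsetT _ _) DA).
rewrite setIC muleC.
apply: (proj2 (@independent_extend _ _ _ P _ _ (labelling id) _
  (@rectangle_setI_closed R I D') mA _ B DB)) => {B DB} B RB.
have mB := labelling_rectangle id RB; split=> //.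
rewrite setIC muleC.
apply: (proj2 (@independent_extend _ _ _ P _ _ (labelling id) _
  (@rectangle_setI_closed R I D) mB _ A DA)) => {A DA mA} A RA.
split; first exact: labelling_rectangle RA.
exact: rectangle_independent RA RB.
Qed.

(** The events that can be approximated to every precision form a sigma-algebra containing the
    boxes. *)
Lemma finite_label_approximation A (eta : R) : 0 < eta -> <<s rectangle setT>> A ->
  exists (J : {fset I}) (C : set (I -> R)), <<s rectangle [set` J]>> C /\
    (P (labelling id @^-1` (A `+` C)) <= eta%:E)%E.
Proof.
move=> eta0 sA.
pose Q : set (set (I -> R)) := [set A | <<s rectangle setT>> A /\
  forall eta : R, 0 < eta -> exists (J : {fset I}) (C : set (I -> R)),
    <<s rectangle [set` J]>> C /\
    (P (labelling id @^-1` (A `+` C)) <= eta%:E)%E].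
suff /(_ _ sA)[_] : <<s rectangle setT>> `<=` Q by apply.
have mP (D : set I) B : <<s rectangle D>> B -> measurable (labelling id @^-1` B).
  by move=> DB;
    have [] := @labelling_law id id B _ (g_sigma_rectangle_sub (@subsetT _ _) DB).
have sT (D : set I) (B : set (I -> R)) : <<s rectangle D>> B -> <<s rectangle
  [set: I]>> B.
  by apply: g_sigma_rectangle_sub; exact: subsetT.
have sigD D : sigma_algebra setT (<<s rectangle D>> : set (set (I -> R))).
  exact: smallest_sigma_algebra.
pose rect D : set (set (I -> R)) := rectangle D.
pose sigT D : measurableType (rect D).-sigma := g_sigma_algebraType (rect D).
have mU D (B C : set (I -> R)) : <<s rectangle D>> B -> <<s rectangle D>> C ->
  <<s rectangle D>> (B `|` C).
  exact: (@measurableU _ (sigT D)).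
have mY D (B C : set (I -> R)) : <<s rectangle D>> B -> <<s rectangle D>> C ->
  <<s rectangle D>> (B `+` C).
  move=> DB DC; apply: mU; exact: (@measurableD _ (sigT D)).
have Q0 : Q set0.
  split; first by have [] := sigD setT.
  move=> e e0; exists fset0, set0; split; first by have [] := sigD [set` fset0].
  by rewrite setYK preimage_set0 measure0 lee_fin ltW.
have QU B C : Q B -> Q C -> Q (B `|` C).
  move=> [sB QB] [sC QC]; split; first exact: mU.
  move=> e e0; have e2 : 0 < e / 2 by rewrite divr_gt0.
  have [J [B' [JB eB]]] := QB _ e2; have [K [C' [KC eC]]] := QC _ e2.
  exists (J `|` K)%fset, (B' `|` C').
  have sub1 : [set` J] `<=` [set` (J `|` K)%fset] by move=> i /= iJ; rewrite inE iJ.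
  have sub2 : [set` K] `<=` [set` (J `|` K)%fset] by move=> i /= iJ;
    rewrite inE iJ orbT.
  split; first by apply: mU;
    [exact: g_sigma_rectangle_sub JB|exact: g_sigma_rectangle_sub KC].
  have sB' := sT _ _ JB; have sC' := sT _ _ KC.
  apply: (@le_trans _ _ (P (labelling id @^-1` (B `+` B') `|` labelling id @^-1`
    (C `+` C')))).
    apply: le_measure; rewrite ?inE.
    - by apply: (mP setT); apply: mY; exact: mU.
    - by apply: measurableU; apply: (mP setT); exact: mY.
    - by move=> w /=; rewrite /setY/=; tauto.
  apply: (le_trans (measureU2 _ _ _)).
  - by apply: (mP setT); exact: mY.
  - by apply: (mP setT); exact: mY.
  by rewrite (splitr e) EFinD leeD.
apply: smallest_sub; last first.
  move=> B [J [C [JT mC ->]]].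
  split; first by apply: sub_sigma_algebra; exists J, C.
  move=> e e0; exists J, [set u | forall i, i \in J -> C i (u i)]; split.
    by apply: sub_sigma_algebra; exists J, C; split.
  by rewrite setYK preimage_set0 measure0 lee_fin ltW.
split=> // [B [sB QB]|F QF].
  split; first by have [_ h _] := sigD setT; exact: h.
  move=> e e0; have [J [C [JC eC]]] := QB e e0.
  exists J, (setT `\` C); split; first by have [_ h _] := sigD [set` J]; exact: h.
  rewrite (_ : _ `+` _ = B `+` C)//; apply/seteqP; split=> u /=;
    have [Bu|nB] := pselect (B u); have [Cu|nC] := pselect (C u); tauto.
have sF : <<s rectangle setT>> (\bigcup_k F k).
  by have [_ _ h] := sigD setT; apply: h => k; have [] := QF k.
split=> // e e0; have e2 : 0 < e / 2 by rewrite divr_gt0.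
(* A countable union is first cut to a finite one, with half of the error spent on the vanishing
   remainder [D n]; the other half approximates the finite union. *)
pose F_ n := \big[setU/set0]_(k < n) F k.
have QF_ n : Q (F_ n) by rewrite /F_; apply: big_ind => // i _; exact: QF.
have FU (n : nat) : F_ n `<=` \bigcup_k F k by exact: bigsetU_bigcup.
pose D n := labelling id @^-1` ((\bigcup_k F k) `\` F_ n).
have mFD n : measurable (D n).
  by apply: (mP setT); apply: (@measurableD _ (sigT setT)) => //; have [] := QF_ n.
have DI : \bigcap_n D n = set0.
  apply/seteqP; split=> w //= h;
    have [] : (\bigcup_k F k) (labelling id w) by have [] := h 0%N Logic.I.
  move=> k _ Fk; have [_] := h k.+1 Logic.I; apply.
  by rewrite /F_ big_ord_recr/=; right.
have : (P \o D) n @[n --> \oo] --> 0%E.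
  rewrite -(measure0 P) -DI; apply: nonincreasing_cvg_mu.
  - by rewrite (le_lt_trans (probability_le1 _ _)) ?ltry.
  - exact: mFD.
  - by rewrite DI.
  - move=> m n mn; apply/subsetPset => w [UFw nFw]; split=> // Fmw; apply: nFw.
    exact: (@subset_bigsetU _ F _ _ mn).
move=> /fine_cvgP[_ /cvgr_lt/(_ _ e2)[n _ /(_ n (leqnn n)) Dn]].
have [sFn QFn] := QF_ n.
have [J [C [JC eC]]] := QFn _ e2.
exists J, C; split=> //; have sC := sT _ _ JC.
apply: (@le_trans _ _ (P (D n `|` labelling id @^-1` (F_ n `+` C)))).
  apply: le_measure; rewrite ?inE.
  - by apply: (mP setT); exact: mY.
  - by apply: measurableU => //; apply: (mP setT); exact: mY.
  move=> w /= [[Uw nC]|[Cw nU]].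
    by have [Fw|nF] := pselect (F_ n (labelling id w)); [right; left|left].
  by right; right; split=> // /FU.
apply: (le_trans (measureU2 _ _ _)) => //.
  by apply: (mP setT); exact: mY.
rewrite (splitr e) EFinD leeD//.
rewrite -[leLHS]fineK ?fin_num_measure// lee_fin ltW//.
Qed.

End Labels.

(** * The spectral gap for factors of i.i.d. labels *)

Section FactorSpectralGap.
Context (R : realType) d (T : measurableType d) (P : probability T R).
Variables (G : groupType) (N : {fset G}) (I : choiceType) (act : G -> I -> I).
Variable U : I -> T -> R.
Hypothesis iidU : iid_uniform P U.
Hypothesis act1 : forall i, act 1%g i = i.
Hypothesis actM : forall g h i, act (g * h)%g i = act g (act h i).
(** Finite transporters make all but finitely many translates of a finite label set disjoint from
    it, which gives finitely supported covariances. *)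
Hypothesis act_finite : forall i j, finite_set [set g | act g i = j].
Hypothesis N_sym : forall s, s \in N -> (s^-1)%g \in N.
Variable c : R.
Hypothesis c_gt0 : 0 < c.
Hypothesis N_gt0 : (0 < #|` N|)%N.
Hypothesis isoperimetric : forall W : {fset G},
  c * #|` W|%:R <= \sum_(s <- N) #|` [fset x in W | (x * s)%g \notin W]%fset|%:R.

Let n : R := #|` N|%:R.
Let n_gt0 : 0 < n. Proof. by rewrite ltr0n. Qed.
Let rho : R := 1 - c ^+ 2 / (16 * n ^+ 2).

(** When [A] says that the factor map opens the identity, equivariance makes this the event that [g]
    is open. *)
Definition factor_event (A : set (I -> R)) (g : G) : set T :=
  labelling U (act g) @^-1` A.

Let actK g : cancel (act g) (act (g^-1)%g).
Proof. by move=> i; rewrite -actM mulVg act1. Qed.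

Let sT D (A : set (I -> R)) : <<s rectangle D>> A -> <<s rectangle setT>> A.
Proof. by apply: g_sigma_rectangle_sub; exact: subsetT. Qed.

Lemma factor_event_law A g : <<s rectangle setT>> A ->
  [/\ measurable (factor_event A g), measurable (labelling U id @^-1` A) &
    P (factor_event A g) = P (labelling U id @^-1` A)].
Proof. by move=> sA; exact (labelling_law iidU (@actK g) sA). Qed.

Let factor_event_id A g :
  factor_event A g = labelling U id @^-1` [set u | A (fun i => u (act g i))].
Proof. by []. Qed.

(** Both sides are translates of the single label event [C], so they have the same probability by
    invariance. *)
Lemma factor_event_setI A B g h : <<s rectangle setT>> A -> <<s rectangle setT>>
  B ->
  P (factor_event A g `&` factor_event B h) =
  P (factor_event A 1%g `&` factor_event B (g^-1 * h)%g).
Proof.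
move=> sA sB.
pose C : set (I -> R) := A `&` [set u | B (fun i => u (act (g^-1 * h)%g i))].
have sC : <<s rectangle setT>> C.
  have mI : setI_closed (<<s rectangle setT>> : set (set (I -> R))).
    by move=> X Y;
      exact: (@measurableI _ (g_sigma_algebraType (rectangle setT : set (set (I
      -> R))) : measurableType _)).
  apply: mI => //; apply: sT; apply: g_sigma_rectangle_shift sB _.
  exact: (can_inj (@actK (g^-1 * h)%g)).
have [_ _ Pg] := factor_event_law g sC; have [_ _ P1] := factor_event_law 1%g sC.
rewrite (_ : _ `&` _ = factor_event C g).
  rewrite Pg -P1; congr (P _); apply/seteqP; split=> w [Aw Bw]; split=> //;
    move: Bw; rewrite /factor_event/= /labelling/=.
    by congr (B _); apply/funext => i; rewrite act1.
  by congr (B _); apply/funext => i; rewrite act1.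
apply/seteqP; split=> w [Aw Bw]; split=> //;
  move: Bw; rewrite /factor_event/= /labelling/=.
  by congr (B _); apply/funext => i; rewrite -actM mulVKg.
by congr (B _); apply/funext => i; rewrite -actM mulVKg.
Qed.

Let factor_event_finite (J : {fset I}) :
  exists W : {fset G}, forall g i, i \in J -> act g i \in J -> g \in W.
Proof.
pose K := \bigcup_(i in [set` J]) \bigcup_(j in [set` J]) [set g | act g i = j].
have finK : finite_set K.
  by apply: bigcup_finite => // i _; apply: bigcup_finite.
exists (fset_set K) => g i iJ gJ; rewrite in_fset_set// inE.
by exists i => //; exists (act g i).
Qed.

(** The covariance function [h] is positive definite by stationarity, and it vanishes at [g] as soon
    as [g] moves [J] off itself, by independence. *)
Lemma finite_label_spectral_gap (J : {fset I}) C p : <<s rectangle [set` J]>> C ->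
  fine (P (factor_event C 1%g)) = p ->
  (\sum_(s <- N) (fine (P (factor_event C 1%g `&` factor_event C s)) - p ^+ 2)) /
    n <=
    rho * (p - p ^+ 2).
Proof.
move=> JC pdef; have sC := sT JC.
pose h g := fine (P (factor_event C 1%g `&` factor_event C g)) - p ^+ 2.
have pE g : measurable (factor_event C g) /\ fine (P (factor_event C g)) = p.
  have [mg _ eg] := factor_event_law g sC; have [_ _ e1] := factor_event_law 1%g sC.
  by split=> //; rewrite -pdef eg e1.
have -> : p - p ^+ 2 = h 1%g by rewrite /h setIid pdef.
apply: (@positive_definite_average_le R G N N_sym c c_gt0 N_gt0 isoperimetric h).
  move=> l; have := @covariance_psd R d T P [seq (u.1, factor_event C u.2) | u <-
    l] p.
  have /[swap]/[apply] : forall u, u \in [seq (u.1, factor_event C u.2) | u <- l] ->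
      measurable u.2 /\ fine (P u.2) = p.
    by move=> _ /mapP[v _ ->]; exact: pE.
  move/le_trans; apply; rewrite le_eqVlt; apply/orP; left; apply/eqP.
  rewrite big_map; apply: eq_bigr => u _; rewrite big_map; apply: eq_bigr => v _.
  by rewrite factor_event_setI.
have [W fW] := factor_event_finite J; exists W => g gW.
have disj : [set` J] `&` (act g @` [set` J]) = set0.
  apply/seteqP; split=> i // [/= iJ [j jJ ji]].
  by move/negP: gW; apply; apply: (fW g j) => //; rewrite ji.
have sC' := g_sigma_rectangle_shift JC (can_inj (@actK g)).
rewrite /h (factor_event_id C g) (_ : factor_event C 1%g = labelling U id @^-1`
  C); last first.
  rewrite /factor_event (_ : labelling U (act 1%g) = labelling U id)//.
  apply/funext => w; apply/funext => i.
  by rewrite /labelling act1.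
rewrite (labelling_independent iidU disj JC sC') -(factor_event_id C g).
have [mg mid eg] := factor_event_law g sC.
rewrite fineM ?fin_num_measure//.
rewrite -eg (pE g).2 expr2 subrr//.
Qed.

Theorem factor_spectral_gap A : <<s rectangle setT>> A ->
  forall p, fine (P (factor_event A 1%g)) = p ->
  (\sum_(s <- N) fine (P (factor_event A 1%g `&` factor_event A s))) / n - p ^+ 2 <=
    rho * (p - p ^+ 2).
Proof.
move=> sA _ <-; set p := fine (P (factor_event A 1%g)); apply/ler_addgt0Pr => e e0.
(* Of the seven shares, two pay for the pair probabilities, two for $q^2$ against $p^2$, and three
   for $q-q^2$ against $p-p^2$. *)
pose eta := e / 7.
have eta0 : 0 < eta by rewrite divr_gt0.
have [J [C [JC AC]]] := finite_label_approximation iidU eta0 sA.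
have sC := sT JC.
pose q := fine (P (factor_event C 1%g)).
have gap := finite_label_spectral_gap JC (erefl q).
have sY : <<s rectangle setT>> (A `+` C).
  pose X := g_sigma_algebraType (rectangle [set: I] : set (set (I -> R))).
  pose M : measurableType _ := X.
  by apply: (@measurableU _ M); exact: (@measurableD _ M).
have near (B E : set T) : measurable B -> measurable E -> forall F, measurable F ->
    B `<=` E `|` F -> fine (P B) <= fine (P E) + fine (P F).
  move=> mB mE F mF BEF;
    rewrite -fineD ?fin_num_measure// fine_le ?fin_numD ?fin_num_measure//.
  apply: (le_trans _ (measureU2 _ mE mF)); apply: le_measure; rewrite ?inE//.
  exact: measurableU.
have mA g : measurable (factor_event A g) by have [] := factor_event_law g sA.
have mC g : measurable (factor_event C g) by have [] := factor_event_law g sC.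
have mY g : measurable (factor_event (A `+` C) g) by have [] := factor_event_law
  g sY.
have PY g : fine (P (factor_event (A `+` C) g)) <= eta.
  have [_ m e'] := factor_event_law g sY.
  by rewrite e' -lee_fin fineK// fin_num_measure.
have pq : p <= q + eta.
  apply: (le_trans (near _ _ (mA 1%g) (mC 1%g) _ (mY 1%g) _));
    last by rewrite lerD2l.
  by move=> w Aw; have [Cw|nC] := pselect (factor_event C 1%g w); [left|right;
    left].
have qp : q <= p + eta.
  apply: (le_trans (near _ _ (mC 1%g) (mA 1%g) _ (mY 1%g) _));
    last by rewrite lerD2l.
  by move=> w Cw; have [Aw|nA] := pselect (factor_event A 1%g w); [left|right;
    right].
have pair s : fine (P (factor_event A 1%g `&` factor_event A s)) <=
    fine (P (factor_event C 1%g `&` factor_event C s)) + 2 * eta.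
  have mYY : measurable (factor_event (A `+` C) 1%g `|` factor_event (A `+` C) s).
    exact: measurableU.
  apply: (le_trans (near _ (factor_event C 1%g `&` factor_event C s) _ _ _ mYY _)).
  - exact: measurableI.
  - exact: measurableI.
  - move=> w [Aw Asw].
    have [Cw|nC] := pselect (factor_event C 1%g w); last by right; left; left.
    have [Csw|nCs] := pselect (factor_event C s w); last by right; right; left.
    by left.
  rewrite lerD2l mulr_natl mulr2n; apply: le_trans (lerD (PY 1%g) (PY s)).
  rewrite -fineD ?fin_num_measure// fine_le ?fin_numD ?fin_num_measure//.
  exact: measureU2.
have p01 : 0 <= p <= 1.
  by rewrite fine_ge0//= -lee_fin fineK ?fin_num_measure// probability_le1.
have q01 : 0 <= q <= 1.
  by rewrite fine_ge0//= -lee_fin fineK ?fin_num_measure// probability_le1.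
have rho0 : 0 < rho := spectral_radius_gt0 c_gt0 N_gt0 isoperimetric.
have rho1 : rho <= 1.
  by rewrite gerBl divr_ge0 ?sqr_ge0// mulr_ge0// sqr_ge0.
have avg : (\sum_(s <- N) fine (P (factor_event A 1%g `&` factor_event A s))) / n <=
    (\sum_(s <- N) (fine (P (factor_event C 1%g `&` factor_event C s)) - q ^+ 2))
      / n
      + (q ^+ 2 + 2 * eta).
  have -> : q ^+ 2 + 2 * eta = (\sum_(s <- N) (q ^+ 2 + 2 * eta)) / n.
    by rewrite sumr_const_seq; field; rewrite gt_eqF.
  rewrite -mulrDl ler_pM2r ?invr_gt0// -big_split/=; apply: ler_sum => s _.
  by have := pair s; lra.
move/andP: p01 => [p0 p1]; move/andP: q01 => [q0 q1].
have sq : q ^+ 2 <= p ^+ 2 + 2 * eta.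
  have -> : q ^+ 2 = p ^+ 2 + (q - p) * (q + p) by ring.
  rewrite lerD2l; have [le_qp|lt_pq] := leP q p.
    apply: (@le_trans _ _ 0); last by rewrite mulr_ge0// ltW.
    by rewrite mulr_le0_ge0 ?subr_le0// addr_ge0.
  by rewrite [leRHS]mulrC ler_pM// ?subr_ge0 ?addr_ge0//; lra.
have sq' : p ^+ 2 <= q ^+ 2 + 2 * eta.
  have -> : p ^+ 2 = q ^+ 2 + (p - q) * (p + q) by ring.
  rewrite lerD2l; have [le_qp|lt_pq] := leP p q.
    apply: (@le_trans _ _ 0); last by rewrite mulr_ge0// ltW.
    by rewrite mulr_le0_ge0 ?subr_le0// addr_ge0.
  by rewrite [leRHS]mulrC ler_pM// ?subr_ge0 ?addr_ge0//; lra.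
have var : rho * (q - q ^+ 2) <= rho * (p - p ^+ 2) + 3 * eta.
  apply: (@le_trans _ _ (rho * (p - p ^+ 2 + 3 * eta)));
    first by rewrite ler_pM2l//; lra.
  rewrite mulrDr lerD2l; apply: ler_piMl => //; rewrite mulr_ge0// ltW//.
have e7 : e = 7 * eta by rewrite /eta; field.
rewrite e7; rewrite -/n in gap; lra.
Qed.

End FactorSpectralGap.

(** * Isoperimetry and actions on Cayley graphs *)

Section CayleyNeighbours.
Variables (G : groupType) (S : {fset G}).

Lemma mem_nbrs x y : (y \in nbrs S x) = ((x^-1 * y)%g \in (S `\ 1%g)%fset).
Proof.
apply/imfsetP/idP => [[s /= sS ->]|xyS]; first by rewrite mulKg.
by exists (x^-1 * y)%g; rewrite //= mulVKg.
Qed.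

Lemma nbrs1_sym : symmetric_set S -> forall s, s \in nbrs S 1%g -> (s^-1)%g \in
  nbrs S 1%g.
Proof.
move=> Ssym s; rewrite !mem_nbrs invg1 !mul1g !inE => /andP[s1 sS].
by rewrite invg_eq1 s1 Ssym.
Qed.

(** Each boundary vertex [y] has some [s] with [y / s] in [W]; exchanging the sums and substituting
    [x = y / s] counts leaving edges. *)
Lemma card_ext_boundary_le (W : {fset G}) :
  (#|` ext_boundary S W| <=
     \sum_(s <- nbrs S 1%g) #|` [fset x in W | (x * s)%g \notin W]%fset|)%N.
Proof.
rewrite card_fset_sum1.
apply: (@leq_trans (\sum_(y <- ext_boundary S W) \sum_(s <- nbrs S 1%g) ((y /
  s)%g \in W))).
  rewrite big_seq [leqRHS]big_seq; apply: leq_sum => y.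
  rewrite inE => /andP[yW /bigfcupP[x /andP[xW _] yx]].
  have sN : (x^-1 * y)%g \in nbrs S 1%g by move: yx; rewrite !mem_nbrs invg1 mul1g.
  rewrite (big_fsetD1 _ sN)/= invgM invgK mulgA mulgV mul1g xW.
  exact: leq_addr.
rewrite exchange_big/=; apply: leq_sum => s _.
rewrite -big_mkcond/= [leqLHS](_ : _ = \sum_(y <- ext_boundary S W | (y / s)%g
  \in W) 1)%N//.
rewrite big_fset_condE/= -card_fset_sum1.
set B := [fset _ | _ in _ & _]%fset.
have <- := card_imfset imfset_key (mem_fin (fset_finpred B)) (@divIg _ s).
apply: fsubset_leq_card; apply/fsubsetP => x /imfsetP[y /=].
rewrite !inE/= => /andP[/andP[yW _] xW] ->; by rewrite xW mulgVK.
Qed.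

Lemma cheeger_isoperimetric (R : realType) (W : {fset G}) :
  cheeger S R * #|` W|%:R <=
  \sum_(s <- nbrs S 1%g) #|` [fset x in W | (x * s)%g \notin W]%fset|%:R.
Proof.
have [->|W0] := eqVneq W fset0.
  by rewrite cardfs0 mulr0 sumr_ge0.
have cW : 0 < #|` W|%:R :> R by rewrite ltr0n cardfs_gt0.
apply: (@le_trans _ _ #|` ext_boundary S W|%:R).
  rewrite -ler_pdivlMr//; apply: ge_inf; last by exists W.
  by exists 0 => _ [V _ ->]; rewrite divr_ge0.
by rewrite -natr_sum ler_nat card_ext_boundary_le.
Qed.

Lemma edge_mul1 (e : edges S) : edge_mul 1%g e = e.
Proof.
apply/val_inj => /=; apply/fsetP => x; apply/imfsetP/idP => [[y /= ye ->]|xe].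
  by rewrite mul1g.
by exists x; rewrite //= mul1g.
Qed.

Lemma edge_mulM g h (e : edges S) : edge_mul (g * h)%g e = edge_mul g (edge_mul h
  e).
Proof.
apply/val_inj => /=; apply/fsetP => x; apply/imfsetP/imfsetP => /= -[y ye ->].
  by exists (h * y)%g; rewrite ?mulgA//; apply/imfsetP; exists y.
by case/imfsetP: ye => z /= ze ->; exists z; rewrite ?mulgA.
Qed.

(** If [x] is an end of [e], then [g * x] is an end of [f], so only the quotients [z / x] are
    possible. *)
Lemma edge_transporter_finite (e f : edges S) : finite_set [set g | edge_mul g e
  = f].
Proof.
have [x [y [yx ev]]] := set_valP e.
apply: (@sub_finite_set _ _ [set` [fset (z / x)%g | z in val f]%fset]) => // g /=
  ge.
apply/imfsetP; exists (g * x)%g; last by rewrite /= mulgK.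
rewrite /= -ge; apply/imfsetP; exists x => //=.
by rewrite [val e]ev !inE eqxx.
Qed.

Lemma vertex_transporter_finite (u v : G) : finite_set [set g | vertex_mul g u = v].
Proof.
apply: (@sub_finite_set _ _ [set (v / u)%g]) => // g /= <-.
by rewrite /vertex_mul mulgK.
Qed.

End CayleyNeighbours.

(** * Open vertices, degrees and the gap for FIID percolations *)

Section SitePercolation.
Context (R : realType) (G : groupType) (S : {fset G}).
Context d (T : measurableType d) (P : probability T R).
Variable X : T -> config G.
Hypothesis sX : site_percolation P X.

Definition open_at g : set T := [set w | X w g].

Lemma measurable_open_at g : measurable (open_at g).
Proof.
have [mX _] := sX; rewrite (_ : open_at g = setT `&` X @^-1` [set x | x g]);
  last by rewrite setTI.
apply: mX => //; apply: sub_sigma_algebra.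
exists g, [set true]; split=> //.
Qed.

Let N := nbrs S 1%g.

Lemma factor_of_iid_spectral_gap (I : choiceType) (act : G -> I -> I) :
  (forall i, act 1%g i = i) ->
  (forall g h i, act (g * h)%g i = act g (act h i)) ->
  (forall i j, finite_set [set g | act g i = j]) ->
  symmetric_set S -> 0 < cheeger S R -> (0 < #|` N|)%N ->
  factor_of_iid P act X ->
  forall p, fine (P (open_at 1%g)) = p ->
  (\sum_(s <- N) fine (P (open_at 1%g `&` open_at s))) / #|` N|%:R - p ^+ 2 <=
    (1 - cheeger S R ^+ 2 / (16 * #|` N|%:R ^+ 2)) * (p - p ^+ 2).
Proof.
move=> act1 actM actf Ssym c0 N0 [U [F [iidU mF eqF XF]]] p.
pose A : set (I -> R) := [set u | F u 1%g].
have mA : <<s rectangle setT>> A.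
  apply: measurable_rectangleT;
    rewrite (_ : A = setT `&` F @^-1` [set x | x 1%g]); last by rewrite setTI.
  apply: mF => //; apply: sub_sigma_algebra.
  exists 1%g, [set true]; split=> //.
(* Equivariance under the inverse of [g] reads the state of [g] as the state of the identity for
   shifted labels. *)
have openE g : open_at g = factor_event act U A g.
  apply/seteqP; split=> w; rewrite /open_at /factor_event /A/= XF.
    have := eqF (g^-1)%g (fun i => U i w); rewrite /translate/vertex_mul/labelling.
    by rewrite invgK => ->; rewrite mulg1.
  have := eqF (g^-1)%g (fun i => U i w); rewrite /translate/vertex_mul/labelling.
  by rewrite invgK => ->; rewrite mulg1.
rewrite openE => pE.
have := factor_spectral_gap iidU act1 actM actf (nbrs1_sym Ssym) c0 N0
  (@cheeger_isoperimetric G S R) mA pE.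
by under [in X in _ -> X]eq_bigr do rewrite openE.
Qed.

Lemma fiid_spectral_gap : symmetric_set S -> 0 < cheeger S R -> (0 < #|` N|)%N ->
  fiid S P X ->
  forall p, fine (P (open_at 1%g)) = p ->
  (\sum_(s <- N) fine (P (open_at 1%g `&` open_at s))) / #|` N|%:R - p ^+ 2 <=
    (1 - cheeger S R ^+ 2 / (16 * #|` N|%:R ^+ 2)) * (p - p ^+ 2).
Proof.
move=> Ssym c0 N0 [|]; apply: factor_of_iid_spectral_gap => //.
- by move=> i; rewrite /vertex_mul mul1g.
- by move=> g h i; rewrite /vertex_mul mulgA.
- exact: vertex_transporter_finite.
- exact: edge_mul1.
- exact: edge_mulM.
- exact: edge_transporter_finite.
Qed.

(** Puts two-point probabilities in the integral form in which weak convergence is stated. *)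
Lemma Rintegral_open_at2 g h :
  \int[P]_w ((X w g && X w h)%:R : R) = fine (P (open_at g `&` open_at h)).
Proof.
rewrite -[in RHS](setIT (_ `&` _)) /Rintegral -integral_indic//; last first.
  by apply: measurableI; exact: measurable_open_at.
congr fine; apply: eq_integral => w _.
rewrite indicE (_ : (w \in _) = X w g && X w h)//.
by apply/idP/idP => [|/andP[wg wh]]; rewrite ?inE//= => -[-> ->].
Qed.

Lemma Rintegral_degree :
  \int[P]_(w in open_at 1%g) ((percolation_degree S (X w) 1%g)%:R : R) =
  \sum_(s <- N) fine (P (open_at 1%g `&` open_at s)).
Proof.
pose l := [seq ((1 : R), open_at 1%g `&` open_at s) | s <- N].
have ml u : u \in l -> measurable u.2.
  by case/mapP => s _ ->; apply: measurableI; exact: measurable_open_at.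
have := (sum_indic_Rintegral P ml).2.
rewrite [X in _ = X -> _]big_map/=; under [X in _ = X -> _]eq_bigr do rewrite mul1r.
move=> <-; rewrite Rintegral_mkcond; apply: eq_Rintegral => w _.
rewrite patchE big_map; under eq_bigr do rewrite mul1r indicE in_setI.
case: ifPn => w1; last by rewrite big1// => s _; rewrite (negbTE w1).
rewrite /percolation_degree card_fset_sum1 natr_sum.
rewrite -big_fset_condE/= big_mkcond/=; apply: eq_bigr => s _.
case: ifPn => ws; first by rewrite mem_set.
by rewrite memNset//; apply/negP.
Qed.

End SitePercolation.

(** * Passage to weak limits *)

Lemma cvg_sum_seq (R : realType) (I : Type) (s : seq I) (u : I -> nat -> R) (l :
  I -> R) :
  (forall i, u i n @[n --> \oo] --> l i) ->
  (\sum_(i <- s) u i n) @[n --> \oo] --> \sum_(i <- s) l i.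
Proof.
move=> ul; elim: s => [|i s IH].
  by rewrite big_nil; under eq_fun do rewrite big_nil; exact: cvg_cst.
rewrite big_cons; under eq_fun do rewrite big_cons.
exact: cvgD.
Qed.

(** Coordinates are discrete, hence locally constant in the product topology. *)
Lemma continuous_two_coordinates (R : realType) (I : choiceType) (g h : I) :
  continuous (fun x : prod_topology (fun _ : I => bool) => (x g && x h)%:R : R).
Proof.
move=> x U /nbhs_singleton/= Ux.
have near_coord i : \forall y \near x, y i = x i.
  by apply: (@proj_continuous I (fun=> bool) i x [set b | b = x i]).
apply: filterS2 (near_coord g) (near_coord h) => y yg yh.
by rewrite /= yg yh.
Qed.

Section SpectralGap.
Context (R : realType) (G : groupType) (S : {fset G}).
Let N := nbrs S 1%g.

(** Both sides are continuous in finitely many two-point probabilities, so the inequality survives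
    the limit. *)
Theorem weak_fiid_spectral_gap d (T : measurableType d) (P : probability T R)
    (X : T -> config G) : site_percolation P X ->
  symmetric_set S -> 0 < cheeger S R -> (0 < #|` N|)%N ->
  fiid S P X \/ weak_fiid S P X ->
  forall p, fine (P (open_at X 1%g)) = p ->
  (\sum_(s <- N) fine (P (open_at X 1%g `&` open_at X s))) / #|` N|%:R - p ^+ 2 <=
    (1 - cheeger S R ^+ 2 / (16 * #|` N|%:R ^+ 2)) * (p - p ^+ 2).
Proof.
move=> sX Ssym c0 N0 [fX|[d_ [T_ [P_ [X_ [fX wX]]]]]] p pE.
  exact: fiid_spectral_gap.
have pair_cvg s : fine (P_ n (open_at (X_ n) 1%g `&` open_at (X_ n) s)) @[n -->
  \oo] -->
    fine (P (open_at X 1%g `&` open_at X s)).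
  rewrite -(Rintegral_open_at2 sX).
  under eq_fun do rewrite -(Rintegral_open_at2 (fX _).1).
  apply: (wX (fun x => (x 1%g && x s)%:R)); first exact: continuous_two_coordinates.
  by exists 1 => x; rewrite normr_nat -[leRHS]/(1%:R) ler_nat; case: (_ && _).
pose q n := fine (P_ n (open_at (X_ n) 1%g)).
(* The one-point probability is the two-point one with both vertices at the identity. *)
have qp : q n @[n --> \oo] --> p.
  by have := pair_cvg 1%g; under eq_fun do rewrite setIid; rewrite setIid pE.
have qqpp : (q n * q n) @[n --> \oo] --> p * p by exact: cvgM.
rewrite [p ^+ 2]expr2; apply: (ler_cvg_to
  (f := fun n => (\sum_(s <- N) fine (P_ n (open_at (X_ n) 1%g `&` open_at (X_ n)
    s))) / #|` N|%:R - q n * q n)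
  (g := fun n => (1 - cheeger S R ^+ 2 / (16 * #|` N|%:R ^+ 2)) * (q n - q n * q
    n)) (a := \oo)).
- apply: cvgB => //; apply: cvgMr_tmp; exact: cvg_sum_seq.
- apply: cvgMl_tmp; exact: cvgB.
- apply: nearW => n; rewrite -[q n * q n]expr2.
  exact: (fiid_spectral_gap Ssym c0 N0 (fX n).2 (erefl (q n))).
Qed.

End SpectralGap.

(** * From the degree condition to the density bound *)

Theorem theorem1p6 (R : realType) (eps gamma : R) (d : nat)
  (eps_gt0 : 0 < eps) (gamma_gt0 : 0 < gamma) (d_ge3 : (3 <= d)%N) :
  exists2 delta : R, 0 < delta &
    forall (Gamma : groupType) (S : {fset Gamma}),
      infinite_set [set: Gamma] ->
      symmetric_set S ->
      generating_set S ->
      #|` nbrs S 1%g| = d ->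
      cheeger S R = gamma ->
    forall (disp : measure_display) (T : measurableType disp)
      (P : probability T R) (X : T -> config Gamma),
      site_percolation P X ->
      fiid S P X \/ weak_fiid S P X ->
      (0 < P [set w | X w 1%g])%E ->
      d%:R * (1 - delta) <=
        cond_expectation P (fun w => (percolation_degree S (X w) 1%g)%:R)
          [set w | X w 1%g] ->
      ((1 - eps)%:E <= P [set w | X w 1%g])%E.
Proof.
have d_gt0 : (0 < d)%N by exact: leq_trans d_ge3.
have dR_gt0 : 0 < d%:R :> R by rewrite ltr0n.
pose k : R := gamma ^+ 2 / (16 * d%:R ^+ 2).
have k_gt0 : 0 < k by rewrite divr_gt0 ?mulr_gt0 ?exprn_gt0.
(* Here [k] is $1-\rho$. Cancelling $p > 0$ from the gap inequality leaves $k(1-p) \le \delta$,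
   which dictates this choice. *)
exists (k * eps); first exact: mulr_gt0.
move=> Gamma S _ Ssym _ dS gS disp T P X sX fX P0 degX.
have mX := measurable_open_at sX 1%g.
set p := fine (P (open_at X 1%g)).
have PE : P (open_at X 1%g) = p%:E by rewrite /p fineK// fin_num_measure.
have p_gt0 : 0 < p by rewrite -lte_fin -PE.
rewrite -/(open_at X 1%g) PE lee_fin.
have := weak_fiid_spectral_gap sX Ssym _ _ fX (erefl p).
rewrite gS dS => /(_ gamma_gt0 d_gt0); rewrite -/k.
move: degX; rewrite /cond_expectation -/(open_at X 1%g) (Rintegral_degree S sX) -/p.
set Q := \sum_(s <- _) _; rewrite ler_pdivlMr// => degX gap.
have Qd : (1 - k * eps) * p <= Q / d%:R by rewrite ler_pdivlMr// mulrC mulrA.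
have : (1 - k * eps) * p - p ^+ 2 <= (1 - k) * (p - p ^+ 2).
  by apply: le_trans gap; rewrite lerD2r.
have -> : (1 - k) * (p - p ^+ 2) = ((1 - k) * (1 - p)) * p by ring.
have -> : (1 - k * eps) * p - p ^+ 2 = (1 - k * eps - p) * p by ring.
rewrite ler_pM2r// => h.
have : k * (1 - p) <= k * eps by lra.
by rewrite ler_pM2l//; lra.
Qed.
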